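(* There exists an absolute constant $C>0$ such that for every $\delta\in(0,1)$, $$\inf_{\mu}\Big(\inf\big\{\mathbb{E}_{\mu^N}[\mu((1+\delta)K_N)] : N\geq \exp\big(C\delta^{-1}\ln(2/\delta)\,n\ln n\big)\big\}\Big)\longrightarrow 1\quad\text{as } n\to\infty,$$ where the outer infimum is over all log-concave probability measures $\mu$ on $\mathbb{R}^n$ with barycenter at the origin, and $K_N=\mathrm{conv}\{X_1,\ldots,X_N\}$ with $X_1,X_2,\ldots$ independent random points distributed according to $\mu$.
   Context: A log-concave probability measure on $\mathbb{R}^n$ is a Borel probability measure $\mu$ such that $\mu(\lambda A+(1-\lambda)B)\geq \mu(A)^{\lambda}\mu(B)^{1-\lambda}$ for all compact $A,B$ and $\lambda\in(0,1)$, and $\mu(H)<1$ for every hyperplane $H$. *)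

(* Defs.v *)
From HB Require Import structures.
From mathcomp Require Import all_boot all_order all_algebra.
From mathcomp Require Import all_classical all_reals all_analysis.
Set Implicit Arguments. Unset Strict Implicit. Unset Printing Implicit Defensive.
Import Order.TTheory GRing.Theory Num.Theory.
Import numFieldNormedType.Exports.
Local Open Scope classical_set_scope.
Local Open Scope ring_scope.

Notation borelRn R n := (g_sigma_algebraType (@open 'rV[R]_n)).

Section Defs.
Variables (R : realType) (n : nat).
Local Notation V := 'rV[R]_n.

Definition mink_comb (l : R) (A B : set V) : set V :=
  [set l *: a + (1 - l) *: b | a in A & b in B].

Definition hyperplane (H : set V) : Prop :=
  exists (u : V) (c : R), u != 0 /\
    H = [set x : V | \sum_(i < n) x ord0 i * u ord0 i = c].

Definition log_concave (mu : probability (borelRn R n) R) : Prop :=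
  (forall (A B : set V) (l : R), compact A -> compact B -> 0 < l < 1 ->
     ((powR (fine (mu A)) l * powR (fine (mu B)) (1 - l))%:E
        <= mu (mink_comb l A B))%E) /\
  (forall H : set V, hyperplane H -> (mu H < 1)%E).

Definition barycenter0 (mu : probability (borelRn R n) R) : Prop :=
  forall i : 'I_n,
    mu.-integrable setT (fun x : borelRn R n => (x ord0 i)%:E) /\
    (\int[mu]_x (x ord0 i)%:E = 0)%E.

Definition hull (s : seq V) : set V :=
  [set y | exists w : 'I_(size s) -> R,
     (forall i, 0 <= w i) /\ \sum_i w i = 1 /\
     y = \sum_i w i *: nth 0 s i].

Definition scale_set (t : R) (A : set V) : set V := [set t *: a | a in A].

(** Expectation with respect to mu^N of F(X_1,...,X_N), F >= 0, written as
    the iterated integral (equal to the product-measure integral by Tonelli). *)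
Fixpoint iter_int (mu : probability (borelRn R n) R) (N : nat)
    (F : seq V -> \bar R) : \bar R :=
  match N with
  | 0 => F [::]
  | N'.+1 => (\int[mu]_x iter_int mu N' (fun s => F (x :: s)))%E
  end.

Definition expected_cover (mu : probability (borelRn R n) R) (delta : R)
    (N : nat) : \bar R :=
  iter_int mu N (fun s => mu (scale_set (1 + delta) (hull s))).

Definition threshold (C delta : R) : R :=
  expR (C * delta^-1 * ln (2 / delta) * n%:R * ln n%:R).

Definition inf_over_N (mu : probability (borelRn R n) R) (C delta : R)
    : \bar R :=
  ereal_inf [set expected_cover mu delta N |
               N in [set N : nat | threshold C delta <= N%:R]].

End Defs.

Definition inf_over_mu (R : realType) (n : nat) (C delta : R) : \bar R :=
  ereal_inf [set inf_over_N mu C delta |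
     mu in [set mu : probability (borelRn R n) R |
              log_concave mu /\ barycenter0 mu]].

(* Main.v *)
Require Import Defs.
From HB Require Import structures.
From mathcomp Require Import all_boot all_order all_algebra.
From mathcomp Require Import all_classical all_reals all_analysis.
From mathcomp Require Import perm measurable_realfun zify ring lra.
Set Implicit Arguments. Unset Strict Implicit. Unset Printing Implicit Defensive.
Import Order.TTheory GRing.Theory Num.Theory.
Import numFieldNormedType.Exports.
Local Open Scope classical_set_scope.
Local Open Scope ring_scope.

(** Lower bound.  Let [first_moment u = E|<u, X>|].  This is a norm, so a basis
    [l_1, ..., l_n] of near-maximal determinant in its unit ball satisfies
    [|a_j| <= 2 first_moment (sum_i a_i l_i)].  The norm
    [phi x = sum_i |<l_i, x>|] has mean at most [n], hence by log-concavity
    (Borell's argument) [P(phi >= 6 n k) <= 2^-k].  Centering and these tails give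
    [P(<v, X> >= 1/32) >= 1 / (96 n^2)] for every [v = sum_i a_i l_i] with
    [1/2 <= max |a_i| <= 1].  Take the grid of such [v] of step [n^-5], which has at
    most [n^(6 n)] points, and for each the halfspace [{<v, .> >= q_v}] of measure
    about [eps = n^(-7 n)].  When [N >= n^(14 n)], with high probability each of
    these halfspaces, cut by [phi <= 6 n^3], contains a sample point; and all but a
    small part of the mass of [mu] avoids the slightly smaller halfspaces
    [{<v, .> >= q_v + eta}].  The factor [1 + delta] absorbs [eta] and the
    discretization of directions, because [q_v >= 1/32].

    Upper bound.  The infimum over an empty family is [+oo], so one log-concave
    centered measure is needed in each dimension: the uniform measure on the cube,
    whose log-concavity follows by induction on the dimension from the
    one-dimensional Prekopa-Leindler inequality applied to measures of sections. *)

(** * Borel sets and compact sets of row vectors *)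

Section borel_rV.
Variables (R : realType) (n : nat).
Local Notation V := 'rV[R]_n.

Lemma open_measurable_rV (A : set V) : open A -> measurable (A : set (borelRn R n)).
Proof. exact: sub_sigma_algebra. Qed.

Lemma closed_measurable_rV (A : set V) : closed A -> measurable (A : set (borelRn R n)).
Proof.
move=> cA; rewrite -[A]setCK; apply: measurableC; apply: open_measurable_rV.
exact: closed_openC.
Qed.

Lemma compact_closed_rV (A : set V) : compact A -> closed A.
Proof. by move=> cA; apply: compact_closed => //; exact: norm_hausdorff. Qed.

Lemma compact_measurable_rV (A : set V) : compact A -> measurable (A : set (borelRn R n)).
Proof. by move=> /compact_closed_rV; exact: closed_measurable_rV. Qed.

Lemma continuous_measurable_rV (f : V -> R) : continuous f ->
  measurable_fun setT (f : borelRn R n -> R).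
Proof.
move=> /continuousP cf; apply: (measurability _ (RGenOpens.measurableE R)).
move=> _ [_ [a [b ->] <-]]; rewrite setTI; apply: open_measurable_rV.
exact/cf/interval_open.
Qed.

(** Each open set is the union of the cubes with rational centre and radius [1 / (k + 1)] that it
    contains. There are countably many of them, and the preimage of a cube is a finite intersection
    of conditions on coordinates. *)
Lemma measurable_fun_rV d (T : measurableType d) (f : T -> V) :
  (forall i, measurable_fun setT (fun t => f t ord0 i)) ->
  measurable_fun setT (f : T -> borelRn R n).
Proof.
move=> mf; apply: (@measurability _ _ _ (borelRn R n) setT f (@open V) erefl).
move=> _ [U oU <-]; rewrite setTI.
pose B (qk : 'rV[rat]_n * nat) : set V :=
  [set x | forall i, `|x ord0 i - ratr (qk.1 ord0 i)| < qk.2.+1%:R^-1].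
have UE : U = \bigcup_(qk in [set qk | B qk `<=` U]) B qk.
  apply/seteqP; split => [x Ux|x [qk /= qkU]]; last exact: qkU.
  have /nbhs_ballP[e /= e0 xeU] : nbhs x U by exact: open_nbhs_nbhs.
  pose k := Num.truncn (2 / e).
  have ke : (k.+1%:R^-1 : R) < e / 2.
    rewrite invf_plt ?posrE ?divr_gt0// invf_div.
    exact: truncnS_gt.
  have k0 : 0 < (k.+1%:R^-1 : R) by rewrite invr_gt0.
  have /choice[q qx] : forall i : 'I_n, exists q : rat, `|x ord0 i - ratr q| < k.+1%:R^-1.
    move=> i.
    have : x ord0 i - k.+1%:R^-1 < x ord0 i by rewrite ltrBlDr ltrDl.
    move=> /rat_in_itvoo[q]; rewrite in_itv/= => /andP[h1 h2]; exists q.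
    rewrite ltr_norml; apply/andP; split; last by rewrite ltrBlDl -ltrBlDr.
    by rewrite (@lt_trans _ _ 0) ?oppr_lt0 ?subr_gt0.
  exists (\row_i q i, k); last by move=> i; rewrite mxE.
  move=> y By; apply: xeU; split => // i j; rewrite ord1.
  have := By j; have := qx j; rewrite /= mxE => h1 h2.
  rewrite /ball/= (_ : x ord0 j - y ord0 j =
    (x ord0 j - ratr (q j)) - (y ord0 j - ratr (q j))); last by ring.
  apply: le_lt_trans (ler_normB _ _) _.
  by rewrite (splitr e) ltrD// (lt_trans _ ke).
rewrite UE preimage_bigcup bigcup_mkcond.
apply: countable_bigcupT_measurable; first exact: countableP.
move=> qk; case: ifP => // _.
have -> : f @^-1` B qk = \bigcap_(i in [set: 'I_n])
    [set t | `|f t ord0 i - ratr (qk.1 ord0 i)| < qk.2.+1%:R^-1].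
  by apply/seteqP; split => t /= h i; [move=> _|]; exact: h.
apply: fin_bigcap_measurable => // i _.
rewrite -[X in measurable X]setTI; apply: measurable_fun_ltr => //.
by apply: measurableT_comp => //; exact: measurable_funB.
Qed.
End borel_rV.

Section compact_mink.
Variables (R : realType) (n : nat).
Local Notation V := 'rV[R]_n.

Lemma compact_mink_comb (l : R) (A B : set V) :
  compact A -> compact B -> compact (mink_comb l A B).
Proof.
move=> cA cB.
have -> : mink_comb l A B = (fun ab : V * V => l *: ab.1 + (1 - l) *: ab.2) @` (A `*` B).
  apply/seteqP; split.
    by move=> _ [a Aa [b Bb <-]]; exists (a, b).
  by move=> _ [[a b] [/= Aa Bb] <-]; exists a => //; exists b.
apply: continuous_compact; last exact: compact_setX.
apply: continuous_subspaceT => -[a b]; apply: cvgD; apply: cvgZl_tmp.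
  exact: cvg_fst.
exact: cvg_snd.
Qed.

Definition dot (u x : V) : R := \sum_(i < n) x ord0 i * u ord0 i.

Lemma continuous_dot u : continuous (dot u).
Proof.
rewrite /dot => x; elim: (index_enum _) => [|i s IH].
  rewrite (_ : (fun _ => _) = cst 0); first exact: cst_continuous.
  by apply/funext => y; rewrite big_nil.
rewrite (_ : (fun _ => _) =
    (fun y : V => y ord0 i * u ord0 i + \sum_(j <- s) y ord0 j * u ord0 j)).
  apply: (@continuousD _ _ _ (fun y : V => y ord0 i * u ord0 i)); last exact: IH.
  apply: (@continuousM _ _ (fun y : V => y ord0 i)); last exact: cst_continuous.
  exact: coord_continuous.
by apply/funext => y; rewrite big_cons.
Qed.

Lemma compact_closed_bounded_rV (A : set V) (M : R) :
  closed A -> (forall x, A x -> forall i, `|x ord0 i| <= M) -> compact A.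
Proof.
move=> cA AM; apply: (subclosed_compact cA
  (@rV_compact _ n (fun=> `[- M, M]%classic) (fun=> @segment_compact R _ _))).
by move=> x Ax i /=; rewrite in_itv/= -ler_norml AM.
Qed.

Lemma norm_coord_le (x : V) i : `|x ord0 i| <= `|x|.
Proof.
by rewrite [leRHS]/Num.norm/= mx_normrE; apply/bigmax_geP; right; exists (ord0, i).
Qed.

Lemma compact_coord_bounded (A : set V) : compact A ->
  exists M : R, forall x, A x -> forall i, `|x ord0 i| <= M.
Proof.
move=> cA; have [M [_ AM]] := compact_bounded cA.
exists (M + 1) => x Ax i.
apply: le_trans (norm_coord_le x i) _.
by apply: (AM (M + 1)) => //; rewrite ltrDl.
Qed.
End compact_mink.

(** * Brunn-Minkowski and Prekopa-Leindler inequalities on the line *)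

(** The preimage is the image of [A] under [x -> c x + d]. The pushforward by the inverse map,
    divided by [c], agrees with Lebesgue measure on half-open intervals, so uniqueness applies. *)
Lemma lebesgue_measure_affine (R : realType) (c d : R) (A : set R) : 0 < c ->
  measurable A ->
  (lebesgue_measure ((fun x : R => c^-1 * (x - d))%R @^-1` A) =
   c%:E * lebesgue_measure A)%E.
Proof.
move=> c0 mA.
pose f (x : measurableTypeR R) : measurableTypeR R := c^-1 * (x - d).
have mf : measurable_fun setT f.
  by apply: measurable_funM => //; apply: measurable_funB.
have ci0 : 0 <= c^-1 by rewrite invr_ge0 ltW.
pose nu : {measure set (measurableTypeR R) -> \bar R} :=
  mscale (NngNum ci0) (pushforward (@lebesgue_measure R) f).
have H : lebesgue_measure A = nu mf A.
  apply: (@lebesgue_measure_unique R (nu mf)) => // _ [[a b]] _ <-.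
  change (lebesgue_measure `]a, b]%classic =
    (c^-1)%:E * lebesgue_measure (f @^-1` `]a, b]%classic))%E.
  have -> : f @^-1` `]a, b] = `]c * a + d, c * b + d]%classic.
    apply/seteqP; split => x /=; rewrite !in_itv/= /f.
      move=> /andP[h1 h2]; apply/andP; split.
        by rewrite -ltrBrDr -ltr_pdivlMl.
      by rewrite -lerBlDr -ler_pdivrMl.
    move=> /andP[h1 h2]; apply/andP; split.
      by rewrite ltr_pdivlMl// ltrBrDr.
    by rewrite ler_pdivrMl// lerBlDr.
  rewrite !lebesgue_measure_itv/= !lte_fin ltrD2r ltr_pM2l//.
  case: ifP => _; last by rewrite mule0.
  rewrite -!EFinD -EFinM; congr (_%:E).
  by field; rewrite gt_eqF.
rewrite H -[nu mf A]/((c^-1)%:E * lebesgue_measure (f @^-1` A))%E muleA -EFinM divff ?gt_eqF// mul1e.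
by [].
Qed.

(** With [a = max A] and [b = min B], the sets [A' = l A + (1 - l) b] and [B' = l a + (1 - l) B]
    both lie in [C], on either side of their common point [p = l a + (1 - l) b]. *)
Lemma brunn_minkowski_compact1 (R : realType) (l : R) (A B C : set R) :
  0 < l < 1 -> compact A -> compact B -> A !=set0 -> B !=set0 ->
  measurable C -> (forall x y, A x -> B y -> C (l * x + (1 - l) * y)) ->
  (l%:E * lebesgue_measure A + (1 - l)%:E * lebesgue_measure B
     <= lebesgue_measure C)%E.
Proof.
move=> /andP[l0 l1] cA cB A0 B0 mC ABC.
have l1' : 0 < 1 - l by rewrite subr_gt0.
have [a /set_mem Aa amax] : exists2 c, c \in A & forall t, t \in A -> t <= c.
  by apply: (@compact_EVT_max _ _ id) => //; by apply: continuous_subspaceT => x; exact: cvg_id.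
have [b /set_mem Bb bmin] : exists2 c, c \in B & forall t, t \in B -> c <= t.
  by apply: (@compact_EVT_min _ _ id) => //; by apply: continuous_subspaceT => x; exact: cvg_id.
have mA : measurable A.
  by apply: closed_measurable; apply: compact_closed => //; exact: Rhausdorff.
have mB : measurable B.
  by apply: closed_measurable; apply: compact_closed => //; exact: Rhausdorff.
rewrite -(lebesgue_measure_affine ((1 - l) * b) l0 mA).
rewrite -(lebesgue_measure_affine (l * a) l1' mB).
set A' := _ @^-1` A; set B' := _ @^-1` B.
have mA' : measurable A'.
  rewrite -[A']setTI; apply: (_ : measurable_fun setT _) => //.
  by apply: measurable_funM => //; apply: measurable_funB.
have mB' : measurable B'.
  rewrite -[B']setTI; apply: (_ : measurable_fun setT _) => //.
  by apply: measurable_funM => //; apply: measurable_funB.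
pose p := l * a + (1 - l) * b.
have A'p x : A' x -> x <= p.
  move=> /mem_set/amax; rewrite ler_pdivrMl// lerBlDr; exact.
have B'p x : B' x -> p <= x.
  move=> /mem_set/bmin; rewrite ler_pdivlMl// lerBrDr addrC; exact.
(* Removing the null point [p] from [A'] makes the two sets disjoint, so that their measures add
   up. *)
have -> : lebesgue_measure A' = lebesgue_measure (A' `\ p).
  apply/eqP; rewrite eq_le; apply/andP; split; last first.
    by apply: le_measure; rewrite ?inE//; exact: measurableD.
  have : A' `<=` (A' `\ p) `|` [set p].
    by move=> x A'x; have [->|/eqP xp] := eqVneq x p; [right|left].
  move=> /(le_measure lebesgue_measure) => /(_ _ _)/le_trans; apply.
  - by rewrite inE.
  - by rewrite inE; apply: measurableU => //; exact: measurableD.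
  rewrite (le_trans (measureU2 _ _ _))//; first exact: measurableD.
  by rewrite [X in (_ + X)%E]lebesgue_measure_set1 adde0.
rewrite -measureU//.
- apply: le_measure; rewrite ?inE//.
    by apply: measurableU => //; exact: measurableD.
  move=> x [[A'x _]|B'x].
    rewrite (_ : x = l * (l^-1 * (x - (1 - l) * b)) + (1 - l) * b); first exact: ABC.
    by field; rewrite gt_eqF.
  rewrite (_ : x = l * a + (1 - l) * ((1 - l)^-1 * (x - l * a))); first exact: ABC.
  by field; rewrite gt_eqF.
- exact: measurableD.
- apply/seteqP; split => // x [[A'x xp] B'x]; apply: xp => /=.
  by apply/eqP; rewrite eq_le A'p// B'p.
Qed.

(** Inner regularity reduces this to compact sets; a point of the set is adjoined to the compact
    approximation to keep it nonempty. *)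
Lemma brunn_minkowski1 (R : realType) (l : R) (A B C : set R) :
  0 < l < 1 -> measurable A -> measurable B -> measurable C ->
  (lebesgue_measure A < +oo)%E -> (lebesgue_measure B < +oo)%E ->
  A !=set0 -> B !=set0 ->
  (forall x y, A x -> B y -> C (l * x + (1 - l) * y)) ->
  (l%:E * lebesgue_measure A + (1 - l)%:E * lebesgue_measure B
     <= lebesgue_measure C)%E.
Proof.
move=> l01 mA mB mC fA fB [a Aa] [b Bb] ABC; have /andP[l0 l1] := l01.
have l1' : 0 < 1 - l by rewrite subr_gt0.
apply/lee_addgt0Pr => e e0.
have inner D d : measurable D -> (lebesgue_measure D < +oo)%E -> D d ->
    exists K : set R, [/\ compact K, K !=set0, K `<=` D &
      (lebesgue_measure D <= lebesgue_measure K + e%:E)%E].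
  move=> mD fD Dd.
  have [K [cK KD De]] := lebesgue_regularity_inner mD fD e0.
  exists (K `|` [set d]); split.
  - by apply: compactU => //; exact: compact_set1.
  - by exists d; right.
  - by move=> x [/KD//|->].
  have mK : measurable K.
    by apply: closed_measurable; apply: compact_closed => //; exact: Rhausdorff.
  rewrite -{1}(setDKU KD) setUC (le_trans (measureU2 _ _ _))//.
    exact: measurableD.
  rewrite leeD ?(ltW De)//.
  by apply: le_measure; rewrite ?inE//; exact: measurableU.
have [K [cK K0 KA AK]] := inner A a mA fA Aa.
have [L [cL L0 LB BL]] := inner B b mB fB Bb.
have KLC : (l%:E * lebesgue_measure K + (1 - l)%:E * lebesgue_measure L <= lebesgue_measure C)%E.
  apply: (brunn_minkowski_compact1 l01) => //.
  by move=> x y /KA ? /LB ?; exact: ABC.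
apply: le_trans (leeD2r e%:E KLC).
apply: (@le_trans _ _ (l%:E * (lebesgue_measure K + e%:E) +
    (1 - l)%:E * (lebesgue_measure L + e%:E))%E).
  by apply: leeD; apply: lee_wpmul2l => //; rewrite lee_fin ltW.
rewrite !ge0_muleDr ?lee_fin ?(ltW e0)//.
rewrite addeACA leeD2l// -!EFinM -EFinD -mulrDl.
by rewrite lee_fin subrKC mul1r.
Qed.

Lemma uniform_probE (R : realType) (a b : R) (ab : a < b) (U : set R) :
  measurable U ->
  uniform_prob ab U = ((b - a)^-1%:E * lebesgue_measure (U `&` `[a, b]))%E.
Proof.
move=> mU; rewrite /uniform_prob integral_uniform_pdf.
rewrite (eq_integral (fun=> (b - a)^-1%:E)); last first.
  by move=> x; rewrite inE/= => -[_]; rewrite /= in_itv/= /uniform_pdf => ->.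
by rewrite integral_cst//=; exact: measurableI.
Qed.

Lemma brunn_minkowski_uniform (R : realType) (a b l : R) (ab : a < b) (A B C : set R) :
  0 < l < 1 -> measurable A -> measurable B -> measurable C ->
  A `&` `[a, b] !=set0 -> B `&` `[a, b] !=set0 ->
  (forall x y, x \in `[a, b] -> y \in `[a, b] ->
     A x -> B y -> C (l * x + (1 - l) * y)) ->
  (l%:E * uniform_prob ab A + (1 - l)%:E * uniform_prob ab B
     <= uniform_prob ab C)%E.
Proof.
move=> l01 mA mB mC A0 B0 ABC; have /andP[l0 l1] := l01.
have fin D : measurable D -> (lebesgue_measure (D `&` `[a, b]) < +oo)%E.
  move=> mD; apply: (@le_lt_trans _ _ (lebesgue_measure `[a, b]%classic)).
    by apply: le_measure; rewrite ?inE//; exact: measurableI.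
  by rewrite /= lebesgue_measure_itv/= -EFinD -(fun_if EFin) ltry.
rewrite !uniform_probE//.
rewrite [X in (X + _)%E]muleCA [X in (_ + X)%E]muleCA -ge0_muleDr; last 2 first.
- by rewrite mule_ge0// lee_fin ltW.
- by rewrite mule_ge0// lee_fin subr_ge0 ltW.
apply: lee_wpmul2l; first by rewrite lee_fin invr_ge0 subr_ge0 ltW.
apply: brunn_minkowski1 => //; [exact: measurableI..|exact: fin|exact: fin|].
move=> x y [Ax xab] [By yab]; split; first exact: ABC.
move: xab yab; rewrite /= !in_itv/= => /andP[x1 x2] /andP[y1 y2].
by apply/andP; split; nra.
Qed.

(** Young's inequality for the conjugate exponents [1 / l] and [1 / (1 - l)]. *)
Lemma weighted_AMGM (R : realType) (x y l : R) : 0 < l < 1 -> 0 <= x -> 0 <= y ->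
  powR x l * powR y (1 - l) <= l * x + (1 - l) * y.
Proof.
move=> /andP[l0 l1] x0 y0.
have l1' : 0 < 1 - l by rewrite subr_gt0.
have := @conjugate_powR R (powR x l) (powR y (1 - l)) l^-1 (1 - l)^-1.
rewrite !powR_ge0 !invr_gt0 !invrK l0 l1' subrKC => /(_ isT isT isT isT erefl).
rewrite -!powRrM !divff ?gt_eqF// !powRr1//.
by rewrite [x * l]mulrC [y * _]mulrC.
Qed.

(** Layer-cake formula, read off from the complementary distribution function of [f] seen as a
    random variable. *)
Lemma ge0_integral_superlevel d (T : measurableType d) (R : realType)
    (P : probability T R) (f : T -> R) :
  measurable_fun setT f -> (forall x, 0 <= f x) ->
  measurable_fun setT (fun r : R => P [set x | r < f x]) /\
  (\int[P]_x (f x)%:E =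
   \int[lebesgue_measure]_(r in `[0%R, +oo[) P [set x | (r < f x)%R])%E.
Proof.
move=> mf f0.
pose X : {RV P >-> R} := HB.pack_for {mfun T >-> R} f (isMeasurableFun.Build _ _ _ _ f mf).
have XE : (fun r : R => P [set x | r < f x]) = ccdf X.
  apply/funext => r; rewrite /ccdf /distribution /= /pushforward; congr (P _).
  by apply/seteqP; split => x /=; rewrite in_itv/= andbT.
split; first by rewrite XE; exact: ccdf_measurable.
have := @ge0_expectation_ccdf _ _ _ P X f0.
rewrite unlock => ->.
by apply: eq_integral => r _; rewrite -XE.
Qed.

Lemma le_integral_conic d (T : measurableType d) (R : realType)
    (m : {measure set T -> \bar R}) (D : set T) (k1 k2 : R) (u v w : T -> \bar R) :
  measurable D -> 0 <= k1 -> 0 <= k2 ->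
  measurable_fun setT u -> measurable_fun setT v -> measurable_fun setT w ->
  (forall x, 0 <= u x)%E -> (forall x, 0 <= v x)%E -> (forall x, 0 <= w x)%E ->
  (forall x, D x -> k1%:E * u x + k2%:E * v x <= w x)%E ->
  (k1%:E * \int[m]_(x in D) u x + k2%:E * \int[m]_(x in D) v x
     <= \int[m]_(x in D) w x)%E.
Proof.
move=> mD k10 k20 mu mv mw u0 v0 w0 uvw.
have mu' : measurable_fun D u by exact: measurable_funS mu.
have mv' : measurable_fun D v by exact: measurable_funS mv.
rewrite -!ge0_integralZl//.
rewrite -ge0_integralD//; last 4 first.
- by move=> r _; rewrite mule_ge0// lee_fin.
- exact: measurable_funeM.
- by move=> r _; rewrite mule_ge0// lee_fin.
- exact: measurable_funeM.
apply: ge0_le_integral => //.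
- by move=> r _; rewrite adde_ge0// mule_ge0// lee_fin.
- by apply: emeasurable_funD; exact: measurable_funeM.
- exact: measurable_funS mw.
Qed.

(** Divide [f] and [g] by their suprema [al] and [be] on [[a, b]], and [h] by [ga]. Superlevel sets
    at a common level [r < 1] are then nonempty and satisfy the linear Brunn-Minkowski inequality.
    Integrating over [r] bounds the integral of [h] below by an arithmetic mean, and [weighted_AMGM]
    passes to the geometric mean. *)
Lemma prekopa_leindler_uniform (R : realType) (a b l : R) (ab : a < b)
    (f g h : R -> R) : 0 < l < 1 ->
  measurable_fun setT f -> measurable_fun setT g -> measurable_fun setT h ->
  (forall x, 0 <= f x <= 1) -> (forall x, 0 <= g x <= 1) ->
  (forall x, 0 <= h x) ->
  (forall x y, x \in `[a, b] -> y \in `[a, b] ->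
     powR (f x) l * powR (g y) (1 - l) <= h (l * x + (1 - l) * y)) ->
  ((powR (fine (\int[uniform_prob ab]_x (f x)%:E)) l *
    powR (fine (\int[uniform_prob ab]_x (g x)%:E)) (1 - l))%:E
   <= \int[uniform_prob ab]_x (h x)%:E)%E.
Proof.
move=> l01 mf mg mh f01 g01 h0 fgh; have /andP[l0 l1] := l01.
have l1' : 0 < 1 - l by rewrite subr_gt0.
set P := uniform_prob ab.
have mab : (a : R) \in `[a, b] by rewrite in_itv/= lexx ltW.
have key (u : R -> R) (al := sup (u @` `[a, b])) : measurable_fun setT u ->
   (forall x, 0 <= u x <= 1) ->
   [/\ 0 <= al, (forall x, x \in `[a, b] -> u x <= al),
    (forall r, r < al -> exists2 x, x \in `[a, b] & r < u x),
    (\int[P]_x (u x)%:E)%E \is a fin_num &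
    al = 0 -> (\int[P]_x (u x)%:E = 0)%E].
  move=> mu u01.
  have hs : has_sup (u @` `[a, b]).
    split; first by exists (u a); exists a.
    by exists 1 => _ [x _ <-]; case/andP: (u01 x).
  have ual x : x \in `[a, b] -> u x <= al.
    by move=> xab; apply: ub_le_sup; [case: hs|exists x].
  have al0 : 0 <= al by apply: le_trans (ual _ mab); case/andP: (u01 a).
  have mEu : measurable_fun setT (fun x => (u x)%:E) by exact/measurable_EFinP.
  split => //.
  - move=> r ral; have [|_ [x xab <-] rx] := sup_adherent (_ : 0 < al - r) hs.
      by rewrite subr_gt0.
    by exists x => //; move: rx; rewrite opprB addrC subrK.
  - rewrite ge0_fin_numE; last by apply: integral_ge0 => x _; rewrite lee_fin; case/andP: (u01 x).
    apply: (@le_lt_trans _ _ (\int[P]_x 1)%E).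
      apply: ge0_le_integral => //.
      + by move=> x _; rewrite lee_fin; case/andP: (u01 x).
      + by move=> x _; rewrite lee_fin; case/andP: (u01 x).
    rewrite integral_cst// mul1e; apply: (@le_lt_trans _ _ 1%E); last exact: ltry.
    exact: probability_le1.
  - move=> ale0; rewrite integral_uniform//; last by move=> x; rewrite lee_fin; case/andP: (u01 x).
    rewrite integral0_eq ?mule0// => x xab.
    congr (_%:E); apply/eqP; rewrite eq_le (le_trans (ual x xab)) ?ale0//.
    by case/andP: (u01 x).
have [/= al0 fal alf finf f0] := key f mf f01.
have [/= be0 gbe beg fing g0] := key g mg g01.
set al := sup (f @` `[a, b]) in al0 fal alf f0.
set be := sup (g @` `[a, b]) in be0 gbe beg g0.
(* If a supremum vanishes, so does the corresponding integral, and the left side is 0. Otherwise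
   division by the suprema is allowed. *)
move: al0; rewrite le_eqVlt => /predU1P[al0|al0].
  by rewrite f0// powR0 ?gt_eqF// mul0r integral_ge0// => x _; rewrite lee_fin.
move: be0; rewrite le_eqVlt => /predU1P[be0|be0].
  by rewrite g0// powR0 ?gt_eqF// mulr0 integral_ge0// => x _; rewrite lee_fin.
pose ga := powR al l * powR be (1 - l).
have ga0 : 0 < ga by rewrite mulr_gt0// powR_gt0.
have scal (u : R -> R) (c : R) : 0 < c -> measurable_fun setT u -> (forall x, 0 <= u x) ->
   [/\ measurable_fun setT (fun r : R => P [set x | r < u x / c]),
     forall r : R, measurable [set x | r < u x / c] &
    (\int[P]_x (u x)%:E = c%:E *
      \int[lebesgue_measure]_(r in `[0%R, +oo[) P [set x | (r < u x / c)%R])%E].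
  move=> c0 mu u0.
  have muc : measurable_fun setT (fun x => u x / c) by exact: measurable_funM.
  have uc0 x : 0 <= u x / c by rewrite divr_ge0// ltW.
  have [mP <-] := @ge0_integral_superlevel _ _ _ P (fun x => u x / c) muc uc0.
  split => //.
    by move=> r; rewrite -[X in measurable X]setTI; exact: measurable_fun_ltr.
  rewrite -ge0_integralZl//.
  - by apply: eq_integral => x _; rewrite -EFinM mulrCA divff ?mulr1// gt_eqF.
  - exact/measurable_EFinP.
  - by move=> x _; rewrite lee_fin.
  - by rewrite lee_fin ltW.
have f00 x : 0 <= f x by case/andP: (f01 x).
have g00 x : 0 <= g x by case/andP: (g01 x).
have [mPf mf' If] := scal f al al0 mf f00.
have [mPg mg' Ig] := scal g be be0 mg g00.
have [mPh mh' ->] := scal h ga ga0 mh h0.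
set Jf := (\int[lebesgue_measure]_(r in `[0%R, +oo[) P [set x | (r < f x / al)%R])%E in If.
set Jg := (\int[lebesgue_measure]_(r in `[0%R, +oo[) P [set x | (r < g x / be)%R])%E in Ig.
have Jf0 : (0 <= Jf)%E by apply: integral_ge0.
have Jg0 : (0 <= Jg)%E by apply: integral_ge0.
have finJ (c : R) J : 0 < c -> (0 <= J)%E -> (c%:E * J)%E \is a fin_num -> J \is a fin_num.
  by move: J => [x| |]// c0 _; rewrite mulry gtr0_sg// mul1e.
have fJf : Jf \is a fin_num by apply: (finJ al Jf al0 Jf0); rewrite -If; exact: finf.
have fJg : Jg \is a fin_num by apply: (finJ be Jg be0 Jg0); rewrite -Ig; exact: fing.
have HJ : (l%:E * Jf + (1 - l)%:E * Jg <=
    \int[lebesgue_measure]_(r in `[0%R, +oo[) P [set x | (r < h x / ga)%R])%E.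
  rewrite /Jf /Jg.
  apply: (@le_integral_conic _ _ R (@lebesgue_measure R) _ _ _ _ _ _ _ (ltW l0) (ltW l1') mPf mPg mPh);
    [exact: measurable_itv|by move=> r; exact: measure_ge0|
     by move=> r; exact: measure_ge0|by move=> r; exact: measure_ge0|].
  move=> r; rewrite /= in_itv/= andbT => r0.
  (* From level 1 on, the superlevel sets of [f / al] and [g / be] miss [[a, b]] and have measure 0.
     Below level 1 they meet it, as Brunn-Minkowski requires. *)
  have [r1|r1] := ltP r 1; last first.
    have P0 (u : R -> R) (c : R) : 0 < c -> (forall x, x \in `[a, b] -> u x <= c) ->
        measurable [set x | r < u x / c] -> P [set x | r < u x / c] = 0%E.
      move=> c0 uc mu; rewrite /P uniform_probE//.
      rewrite (_ : _ `&` _ = set0) ?measure0 ?mule0//.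
      apply/seteqP; split => // x [/= rx xab].
      have uxc : u x / c <= 1 by rewrite ler_pdivrMr// mul1r uc.
      by have := lt_le_trans (le_lt_trans r1 rx) uxc; rewrite ltxx.
    by rewrite (P0 f)// (P0 g)// !mule0 adde0.
  apply: brunn_minkowski_uniform => //.
  - have [x xab fx] := alf (r * al) ltac:(by rewrite gtr_pMl).
    by exists x; split => //=; rewrite ltr_pdivlMr.
  - have [x xab gx] := beg (r * be) ltac:(by rewrite gtr_pMl).
    by exists x; split => //=; rewrite ltr_pdivlMr.
  move=> x y xab yab /=; rewrite !ltr_pdivlMr// => fx gy.
  apply: lt_le_trans (fgh x y xab yab).
  have rE : r = powR r l * powR r (1 - l).
    by rewrite -powRD ?subrKC ?powRr1// oner_eq0.
  rewrite rE /ga mulrACA -!powRM ?(ltW al0) ?(ltW be0)//.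
  apply: ltr_pM; rewrite ?powR_ge0//; apply: gt0_ltr_powR => //.
  - by rewrite nnegrE mulr_ge0// ltW.
  - by rewrite nnegrE.
  - by rewrite nnegrE mulr_ge0// ltW.
  - by rewrite nnegrE.
clearbody Jf Jg.
apply: le_trans (lee_wpmul2l _ HJ); last by rewrite lee_fin ltW.
rewrite If Ig -(fineK fJf) -(fineK fJg) -!EFinM lee_fin /=.
move: (fine Jf) (fine_ge0 Jf0) (fine Jg) (fine_ge0 Jg0) => x x0 y y0.
rewrite !powRM ?(ltW al0) ?(ltW be0)// mulrACA ler_wpM2l ?(ltW ga0)//.
exact: weighted_AMGM.
Qed.

(** * The uniform measure on the cube *)

Section cons_rV.
Variables (R : realType) (n : nat).

Definition cons_rV (t : R) (x : 'rV[R]_n) : 'rV[R]_n.+1 :=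
  \row_i (if unlift ord0 i is Some j then x ord0 j else t).

Lemma cons_rV0 t x : cons_rV t x ord0 ord0 = t.
Proof. by rewrite mxE unlift_none. Qed.

Lemma cons_rVS t x j : cons_rV t x ord0 (lift ord0 j) = x ord0 j.
Proof. by rewrite mxE liftK. Qed.

Lemma cons_rV_comb l t x s y :
  l *: cons_rV t x + (1 - l) *: cons_rV s y =
  cons_rV (l * t + (1 - l) * s) (l *: x + (1 - l) *: y).
Proof.
by apply/rowP => i; rewrite !mxE; case: unliftP => [j|] _; rewrite ?mxE.
Qed.

Lemma continuous_cons_rV t : continuous (cons_rV t).
Proof.
move=> x A /nbhs_ballP[e e0 xeA]; apply/nbhs_ballP; exists e => //= y [_ xy].
apply: xeA; split => // i j; rewrite ord1 !mxE.
by case: unliftP => [k|] _; [exact: xy|exact: ballxx].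
Qed.

Lemma measurable_cons_rV :
  measurable_fun setT ((fun tx => cons_rV tx.1 tx.2) :
    measurableTypeR R * borelRn R n -> borelRn R n.+1).
Proof.
apply: measurable_fun_rV => i; case: (unliftP ord0 i) => [j ->|->].
  under eq_fun do rewrite cons_rVS.
  apply: (@measurableT_comp _ _ _ _ _ _ (fun x : borelRn R n => x ord0 j)) => //.
  by apply: continuous_measurable_rV; exact: coord_continuous.
under eq_fun do rewrite cons_rV0.
exact: measurable_fst.
Qed.

Lemma compact_cons_section (A : set 'rV[R]_n.+1) t : compact A ->
  compact [set x | A (cons_rV t x)].
Proof.
move=> cA; have [M AM] := compact_coord_bounded cA.
apply: (@compact_closed_bounded_rV _ _ _ M) => [|x /AM h i].
  apply: (@preimage_closed _ _ (cons_rV t)); last exact: compact_closed_rV.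
  by move=> x _; exact: continuous_cons_rV.
by have := h (lift ord0 i); rewrite cons_rVS.
Qed.

End cons_rV.

Section product_step.
Variables (R : realType) (n : nat) (P : probability (measurableTypeR R) R).
Variable mu : probability (borelRn R n) R.

Definition cons_mfun : {mfun (measurableTypeR R * borelRn R n)%type >-> borelRn R n.+1} :=
  HB.pack_for {mfun (measurableTypeR R * borelRn R n)%type >-> borelRn R n.+1}
    ((fun tx => cons_rV tx.1 tx.2) : measurableTypeR R * borelRn R n -> borelRn R n.+1)
    (isMeasurableFun.Build _ _ _ _ _ (@measurable_cons_rV R n)).

(** The product measure is transported along [cons_rV] so that it lives on the Borel sets of row
    vectors. *)
Definition cons_prob : probability (borelRn R n.+1) R :=
  distribution (P \x mu)%E cons_mfun.

Lemma cons_probE (A : set 'rV[R]_n.+1) : measurable (A : set (borelRn R n.+1)) ->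
  measurable_fun setT (fun t : measurableTypeR R => mu [set x | A (cons_rV t x)]) /\
  cons_prob A = (\int[P]_t mu [set x | A (cons_rV t x)])%E.
Proof.
move=> mA.
have mA' : measurable (cons_mfun @^-1` A).
  by rewrite -[X in measurable X]setTI; exact: (@measurable_cons_rV R n).
have sE t : xsection (cons_mfun @^-1` A) t = [set x | A (cons_rV t x)].
  by apply/seteqP; split => x /=; rewrite /xsection/= ?inE//= => ?; rewrite ?inE.
split.
  have := @measurable_fun_xsection _ _ _ _ R mu (cons_mfun @^-1` A) mA'.
  by congr (measurable_fun _ _); apply/funext => t /=; rewrite sE.
rewrite /cons_prob /distribution /pushforward/=.
rewrite /product_measure1; apply: eq_integral => t _ /=; by rewrite sE.
Qed.

Lemma cons_prob_integral (f : 'rV[R]_n.+1 -> R) :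
  measurable_fun setT (f : borelRn R n.+1 -> R) ->
  (\int[P]_t \int[mu]_x `|f (cons_rV t x)|%:E < +oo)%E ->
  cons_prob.-integrable setT (EFin \o f) /\
  (\int[cons_prob]_x (f x)%:E = \int[P]_t \int[mu]_x (f (cons_rV t x))%:E)%E.
Proof.
move=> mf foo.
have mEf : measurable_fun setT (EFin \o f : borelRn R n.+1 -> _) by exact/measurable_EFinP.
have mc := @measurable_cons_rV R n.
have mfc : measurable_fun setT ((EFin \o f) \o cons_mfun).
  exact: measurableT_comp.
have intf : (P \x mu)%E.-integrable setT ((EFin \o f) \o cons_mfun).
  by apply/(integrable12ltyP _ _ mfc).
split.
  by apply: (@integrable_pushforward _ _ _ _ _ cons_mfun).
rewrite (@integral_pushforward _ _ _ _ _ cons_mfun mc (P \x mu)%E setT (EFin \o f))//.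
by rewrite -integral12_prod_meas1.
Qed.

End product_step.

Section uniform_centered.
Variable R : realType.

Lemma ltN11_real : (-1 : R) < 1. Proof. lra. Qed.
Definition unif11 : probability (measurableTypeR R) R := uniform_prob ltN11_real.

Lemma unif11E (U : set R) : measurable U ->
  unif11 U = ((1 - -1)^-1%:E * lebesgue_measure (U `&` `[(-1)%R, 1%R]))%E.
Proof. by move=> mU; exact: uniform_probE. Qed.

Lemma unif11_set1 (t : R) : unif11 [set t] = 0%E.
Proof.
rewrite unif11E//.
apply/eqP; rewrite mule_eq0; apply/orP; right.
rewrite eq_le measure_ge0 andbT.
apply: (@le_trans _ _ (lebesgue_measure [set t])).
  by apply: le_measure; rewrite ?inE//; exact: measurableI.
by rewrite lebesgue_measure_set1.
Qed.

Lemma unif11_integral_norm_lty : (\int[unif11]_t `|t|%:E < +oo)%E.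
Proof.
rewrite /unif11 integral_uniform//; last first.
  by apply/measurable_EFinP; exact: normr_measurable.
have h : (\int[lebesgue_measure]_(x in `[(-1 : R)%R, 1%R]) `|x|%:E <=
    \int[lebesgue_measure]_(x in `[(-1 : R)%R, 1%R]) 1)%E.
  apply: ge0_le_integral => //.
  - by apply/measurable_EFinP; exact: normr_measurable.
  - by move=> x; rewrite /= in_itv/= lee_fin ler_norml.
apply: le_lt_trans (lee_wpmul2l _ h) _; first by rewrite lee_fin invr_ge0; lra.
rewrite integral_cst//= mul1e lebesgue_measure_itv/= lte_fin ltN11_real.
by rewrite -EFinD -EFinM ltry.
Qed.

(** The measure is invariant under negation, so its mean equals its own opposite. *)
Lemma unif11_mean0 : (\int[unif11]_t t%:E = 0)%E.
Proof.
pose N : measurableTypeR R -> measurableTypeR R := -%R.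
have mN : measurable_fun setT N by exact: oppr_measurable.
have mid : measurable_fun setT (EFin : measurableTypeR R -> _) by exact/measurable_EFinP.
have intid : unif11.-integrable setT (EFin : measurableTypeR R -> _).
  by apply/integrableP; split => //; exact: unif11_integral_norm_lty.
have pN A : measurable A -> pushforward unif11 N A = unif11 A.
  move=> mA.
  have mNA : measurable (N @^-1` A) by rewrite -[X in measurable X]setTI; exact: mN.
  rewrite /pushforward !unif11E//; congr (_ * _)%E.
  rewrite -[RHS]lebesgue_measureN; last exact: measurableI.
  rewrite /pushforward; congr (lebesgue_measure _).
  apply/seteqP; split => x /=; rewrite !in_itv/= => -[Ax /andP[h1 h2]];
    (split; [exact: Ax|by apply/andP; split; lra]).
have intN : unif11.-integrable (N @^-1` setT) (EFin \o N).
  rewrite preimage_setT; have := integrableN intid; apply: eq_integrable => // x _.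
have I1 : (\int[unif11]_t t%:E = \int[unif11]_t (N t)%:E)%E.
  rewrite -[RHS](@integral_pushforward _ _ _ _ _ N mN unif11 setT EFin mid intN measurableT).
  by apply: eq_measure_integral => A mA _; exact/esym/pN.
have I2 : (\int[unif11]_t (N t)%:E = - \int[unif11]_t t%:E)%E.
  by rewrite -integralN//; apply: integrable_add_def.
have fin := integrable_fin_num measurableT intid.
move: I1; rewrite I2 -(fineK fin) -EFinN => -[] /eqP.
by rewrite -addr_eq0 -mulr2n mulrn_eq0/= => /eqP ->.
Qed.

End uniform_centered.

Section cube.
Variable R : realType.

(** Apply Prekopa-Leindler to the measures of sections at first coordinate [t]. The combination of
    the section of [A] at [x] and that of [B] at [y] lies in the section of [mink_comb l A B] at
    [l x + (1 - l) y], so log-concavity of [mu] gives the pointwise hypothesis. *)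
Lemma log_concave_cons_unif n (mu : probability (borelRn R n) R) :
  (forall (A B : set 'rV[R]_n) (l : R), compact A -> compact B -> 0 < l < 1 ->
     ((powR (fine (mu A)) l * powR (fine (mu B)) (1 - l))%:E
        <= mu (mink_comb l A B))%E) ->
  forall (A B : set 'rV[R]_n.+1) (l : R), compact A -> compact B -> 0 < l < 1 ->
     ((powR (fine (cons_prob (unif11 R) mu A)) l *
       powR (fine (cons_prob (unif11 R) mu B)) (1 - l))%:E
        <= cons_prob (unif11 R) mu (mink_comb l A B))%E.
Proof.
move=> lc A B l cA cB l01.
pose C := mink_comb l A B.
have cC : compact C by exact: compact_mink_comb.
have sec D (t : R) : compact D -> measurable ([set x | D (cons_rV t x)] : set (borelRn R n)).
  by move=> cD; apply: compact_measurable_rV; exact: compact_cons_section.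
have fin D : compact D -> forall t, mu [set x | D (cons_rV t x)] \is a fin_num.
  by move=> cD t; apply: fin_num_measure; exact: sec.
have fE D : compact D ->
    measurable_fun setT (fun t : R => fine (mu [set x | D (cons_rV t x)])) /\
    cons_prob (unif11 R) mu D =
    (\int[unif11 R]_t (fine (mu [set x | D (cons_rV t x)]))%:E)%E.
  move=> cD; have [mD ->] := cons_probE (unif11 R) mu (compact_measurable_rV cD).
  split; first exact: measurableT_comp.
  by apply: eq_integral => t _; rewrite fineK// fin.
have [mA ->] := fE A cA.
have [mB ->] := fE B cB.
have [mC ->] := fE C cC.
have b01 D : compact D -> forall t, 0 <= fine (mu [set x | D (cons_rV t x)]) <= 1.
  move=> cD t; rewrite fine_ge0//= -lee_fin fineK ?fin//.
  by apply: probability_le1; exact: sec.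
apply: prekopa_leindler_uniform => //.
- exact: b01.
- exact: b01.
- by move=> x; case/andP: (b01 C cC x).
move=> x y _ _; rewrite -lee_fin (fineK (fin _ cC _)).
have H1 := lc _ _ _ (@compact_cons_section R n A x cA)
  (@compact_cons_section R n B y cB) l01.
apply: (le_trans H1).
apply: le_measure; rewrite ?inE.
- apply: compact_measurable_rV; apply: compact_mink_comb; exact: compact_cons_section.
- exact: sec.
move=> _ [u Au [v Bv <-]] /=; rewrite -cons_rV_comb.
by exists (cons_rV x u) => //; exists (cons_rV y v).
Qed.

Lemma closed_hyperplane n (H : set 'rV[R]_n) : hyperplane H -> closed H.
Proof.
move=> [u [c [_ ->]]].
rewrite (_ : [set _ | _] = dot u @^-1` [set c])//.
apply: preimage_closed; first by move=> x _; exact: continuous_dot.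
exact: closed_eq.
Qed.

Lemma hyperplane_cons_unif n (mu : probability (borelRn R n) R) :
  (forall H, hyperplane H -> mu H = 0%E) ->
  forall H, hyperplane H -> cons_prob (unif11 R) mu H = 0%E.
Proof.
move=> mu0 H hH; have mH := closed_measurable_rV (closed_hyperplane hH).
have [mF ->] := cons_probE (unif11 R) mu mH.
have [u [c [u0 HE]]] := hH.
pose v : 'rV[R]_n := \row_j u ord0 (lift ord0 j).
have sE t : [set x | H (cons_rV t x)] =
    [set x | \sum_(i < n) x ord0 i * v ord0 i = c - t * u ord0 ord0].
  rewrite HE; apply/seteqP; split => x /=; rewrite big_ord_recl cons_rV0.
    move=> <-; rewrite [RHS]addrC addKr; apply: eq_bigr => i _.
    by rewrite mxE cons_rVS.
  move=> h; rewrite (_ : \sum_(i < n) _ = c - t * u ord0 ord0) ?subrKC// -h.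
  by apply: eq_bigr => i _; rewrite cons_rVS mxE.
(* If the normal has a nonzero component beyond the first, every section is a hyperplane and hence
   null. Otherwise the hyperplane fixes the first coordinate at [t0], which has probability 0 under
   [unif11]. *)
have [v0|v0] := eqVneq v 0; last first.
  have z t : mu [set x | H (cons_rV t x)] = 0%E.
    by rewrite sE mu0//; exists v, (c - t * u ord0 ord0).
  under eq_integral do rewrite z.
  by rewrite integral0.
have uu0 : u ord0 ord0 != 0.
  apply: contra u0 => /eqP u00; apply/eqP/rowP => i; rewrite mxE.
  by case: (unliftP ord0 i) => [j ->|->//]; move/rowP/(_ j): v0; rewrite !mxE.
pose t0 := c / u ord0 ord0.
apply/eqP; rewrite eq_le; apply/andP; split; last by apply: integral_ge0.
apply: (@le_trans _ _ (\int[unif11 R]_t (\1_[set t0] t)%:E)%E); last first.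
  rewrite -[leRHS](unif11_set1 t0) integral_indic//.
  by rewrite le_eqVlt; apply/orP; left; apply/eqP; congr (unif11 R _); rewrite setIT.
apply: ge0_le_integral => //.
  by apply/measurable_EFinP.
move=> t _; rewrite sE indicE; have [tt0|tt0] := eqVneq t t0.
  rewrite tt0 mem_set//; apply: probability_le1; rewrite -sE.
  apply: closed_measurable_rV; apply: (@preimage_closed _ _ (cons_rV _)).
    by move=> x _; exact: continuous_cons_rV.
  exact: closed_hyperplane.
rewrite memNset; last by move=> /= /eqP; exact/negP.
rewrite (_ : [set _ | _] = set0) ?measure0//.
apply/seteqP; split => // x /=; rewrite big1 => [/esym/eqP|i _]; last first.
  by rewrite v0 mxE mulr0.
rewrite subr_eq0 => /eqP cE; move/negP: tt0; apply; rewrite /t0 cE mulfK//.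
Qed.

Lemma barycenter0_cons_unif n (mu : probability (borelRn R n) R) :
  barycenter0 mu -> barycenter0 (cons_prob (unif11 R) mu).
Proof.
move=> bmu i.
have mcoord : measurable_fun setT ((fun x => x ord0 i) : borelRn R n.+1 -> R).
  by apply: continuous_measurable_rV; exact: coord_continuous.
have cst (c : R) : (\int[mu]_x c%:E = c%:E)%E.
  rewrite integral_cst// [X in (_ * X)%E](_ : _ = 1%E) ?mule1//.
  exact: probability_setT.
have cstP (k : \bar R) : (\int[unif11 R]_t k = k)%E.
  rewrite integral_cst// [X in (_ * X)%E](_ : _ = 1%E) ?mule1//.
  exact: probability_setT.
case: (unliftP ord0 i) => [j ij|i0].
  have [intj Ij] := bmu j; have /integrableP[_ normj] := intj.
  have [] := @cons_prob_integral R n (unif11 R) mu (fun x => x ord0 i) mcoord.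
    rewrite ij; under eq_integral do under eq_integral do rewrite cons_rVS.
    by rewrite cstP.
  move=> ? ->; split => //.
  rewrite ij; under eq_integral do under eq_integral do rewrite cons_rVS.
  by rewrite Ij integral0.
have [] := @cons_prob_integral R n (unif11 R) mu (fun x => x ord0 i) mcoord.
  rewrite i0; under eq_integral do under eq_integral do rewrite cons_rV0.
  under eq_integral do rewrite cst.
  exact: unif11_integral_norm_lty.
move=> ? ->; split => //.
rewrite i0; under eq_integral do under eq_integral do rewrite cons_rV0.
under eq_integral do rewrite cst.
exact: unif11_mean0.
Qed.

Lemma exists_log_concave_barycenter0 n :
  exists mu : probability (borelRn R n) R, log_concave mu /\ barycenter0 mu.
Proof.
(* The induction carries the stronger property that hyperplanes are null, which passes to the
   product by integrating over sections. *)
suff [mu [lc hyp bar]] : exists mu : probability (borelRn R n) R,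
  [/\ (forall (A B : set 'rV[R]_n) (l : R), compact A -> compact B -> 0 < l < 1 ->
     ((powR (fine (mu A)) l * powR (fine (mu B)) (1 - l))%:E
        <= mu (mink_comb l A B))%E),
     (forall H, hyperplane H -> mu H = 0%E) & barycenter0 mu].
  by exists mu; do 2!split => //; move=> H /hyp ->; rewrite lte01.
elim: n => [|n [mu [lc hyp bar]]]; last first.
  exists (cons_prob (unif11 R) mu); split.
  - exact: log_concave_cons_unif.
  - exact: hyperplane_cons_unif.
  - exact: barycenter0_cons_unif.
(* In dimension 0 the space is a single point, and there is no hyperplane because no normal is
   nonzero. *)
pose mu : probability (borelRn R 0) R := @dirac _ (borelRn R 0) (0 : 'rV[R]_0) R.
exists mu; split => [A B l cA cB /andP[l0 l1]|H [u [c [/eqP u0 _]]]|[]//]; last first.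
  by exfalso; apply: u0; apply/rowP => -[].
have all0 (x : 'rV[R]_0) : x = 0 by apply/rowP => -[].
have muN (D : set 'rV[R]_0) : ~ D 0 -> mu D = 0%E.
  by move=> D0; rewrite /mu/= diracE memNset.
have muY (D : set 'rV[R]_0) : D 0 -> mu D = 1%E.
  by move=> D0; rewrite /mu/= diracE mem_set.
have [A0|A0] := pselect (A 0); last first.
  by rewrite (muN A)//= powR0 ?gt_eqF// mul0r.
have [B0|B0] := pselect (B 0); last first.
  by rewrite (muN B)//= [X in _ * X]powR0 ?mulr0// gt_eqF// subr_gt0.
rewrite (muY A)// (muY B)// muY/= ?powR1 ?mul1r//.
by exists 0 => //; exists 0 => //; rewrite !scaler0 addr0.
Qed.

End cube.

(** * Convex hulls of finite sets *)

Section dot_theory.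
Variables (R : realType) (n : nat).
Local Notation V := 'rV[R]_n.

Lemma dotC (u x : V) : dot u x = dot x u.
Proof. by apply: eq_bigr => i _; rewrite mulrC. Qed.

Lemma dotDr (u x y : V) : dot u (x + y) = dot u x + dot u y.
Proof. by rewrite -big_split; apply: eq_bigr => i _; rewrite mxE mulrDl. Qed.

Lemma dotZr (u x : V) (a : R) : dot u (a *: x) = a * dot u x.
Proof. by rewrite mulr_sumr; apply: eq_bigr => i _; rewrite mxE mulrA. Qed.

Lemma dotNr (u x : V) : dot u (- x) = - dot u x.
Proof. by rewrite -scaleN1r dotZr mulN1r. Qed.

Lemma dotDl (u v x : V) : dot (u + v) x = dot u x + dot v x.
Proof. by rewrite dotC dotDr !(dotC x). Qed.

Lemma dotZl (u x : V) (a : R) : dot (a *: u) x = a * dot u x.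
Proof. by rewrite dotC dotZr (dotC x). Qed.

Lemma dotNl (u x : V) : dot (- u) x = - dot u x.
Proof. by rewrite dotC dotNr (dotC x). Qed.

Lemma dot_subZ (u w : V) (t : R) : dot (u - t *: w) (u - t *: w) =
  dot u u - 2 * (t * dot u w) + t * (t * dot w w).
Proof. rewrite dotDr dotNr dotZr !dotDl !dotNl !dotZl (dotC w u); ring. Qed.

Lemma dot_ge0 (u : V) : 0 <= dot u u.
Proof. by apply: sumr_ge0 => i _; rewrite -expr2 sqr_ge0. Qed.

Lemma dot_gt0 (u : V) : u != 0 -> 0 < dot u u.
Proof.
move=> u0; rewrite lt_neqAle dot_ge0 andbT eq_sym; apply: contra u0 => /eqP d0.
apply/eqP/rowP => i; rewrite mxE; apply/eqP.
have h : \sum_(j < n) u ord0 j ^+ 2 = 0.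
  by rewrite -[RHS]d0; apply: eq_bigr => j _; rewrite expr2.
have h' := psumr_eq0P (fun j _ => sqr_ge0 (u ord0 j)) h.
by have /eqP := h' i isT; rewrite sqrf_eq0.
Qed.

Lemma continuous_sum_seq (T : topologicalType) (W : normedModType R) (I : Type)
    (r : seq I) (F : I -> T -> W) :
  (forall i, continuous (F i)) -> continuous (fun x => \sum_(i <- r) F i x).
Proof.
move=> cF x; elim: r => [|i r IH].
  rewrite (_ : (fun _ => _) = cst 0); first exact: cst_continuous.
  by apply/funext => y; rewrite big_nil.
rewrite (_ : (fun _ => _) = (fun y => F i y + \sum_(j <- r) F j y)).
  by apply: (@continuousD _ _ _ (F i)); [exact: cF|exact: IH].
by apply/funext => y; rewrite big_cons.
Qed.

(** The hull is the continuous image of the simplex of weights, which is closed and bounded. *)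
Lemma hull_compact (s : seq V) : compact (hull s).
Proof.
pose W := [set w : 'rV[R]_(size s) | (forall i, 0 <= w ord0 i) /\ \sum_i w ord0 i = 1].
pose f (w : 'rV[R]_(size s)) : V := \sum_i w ord0 i *: nth 0 s i.
have -> : hull s = f @` W.
  apply/seteqP; split => [y [w [w0 [w1 ->]]]|_ [w [w0 w1] <-]].
    exists (\row_i w i).
      split => [i|]; first by rewrite mxE.
      by rewrite -[RHS]w1; apply: eq_bigr => i _; rewrite mxE.
    by apply: eq_bigr => i _; rewrite mxE.
  by exists (fun i => w ord0 i).
apply: continuous_compact.
  apply: continuous_subspaceT; apply: continuous_sum_seq => i w.
  apply: (@continuous_comp _ _ _ (fun w : 'rV[R]_(size s) => w ord0 i) (fun k : R => k *: nth 0 s i)).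
    exact: coord_continuous.
  exact: scalel_continuous.
apply: (@compact_closed_bounded_rV _ _ _ 1) => [|w [w0 w1] i]; last first.
  rewrite ger0_norm// -w1 (bigD1 i)//= lerDl; exact: sumr_ge0.
have -> : W = (\bigcap_(i in [set: 'I_(size s)]) [set w : 'rV[R]_(size s) | 0 <= w ord0 i]) `&`
     ((fun w : 'rV[R]_(size s) => \sum_i w ord0 i) @^-1` [set 1]).
  apply/seteqP; split => w [w0 w1]; split => //.
    by move=> i _; exact: w0.
  by move=> i; exact: w0.
apply: closedI.
  apply: closed_bigI => i _.
  apply: (@preimage_closed _ _ (fun w : 'rV[R]_(size s) => w ord0 i) [set x | 0 <= x]).
    by move=> w _; exact: coord_continuous.
  exact: closed_ge.
apply: preimage_closed; last exact: closed_eq.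
move=> w _; apply: (@continuous_sum_seq _ R^o) => i; exact: coord_continuous.
Qed.

Lemma hull_convex (s : seq V) (x y : V) (t : R) : 0 <= t <= 1 ->
  hull s x -> hull s y -> hull s (x + t *: (y - x)).
Proof.
move=> /andP[t0 t1] [w [w0 [w1 ->]]] [v [v0 [v1 ->]]].
exists (fun i => (1 - t) * w i + t * v i); split; [|split].
- by move=> i; rewrite addr_ge0// mulr_ge0// subr_ge0.
- by rewrite big_split/= -!mulr_sumr w1 v1; ring.
rewrite -sumrB scaler_sumr -big_split/=; apply: eq_bigr => i _.
rewrite -scalerBl scalerA -scalerDl; congr (_ *: _); ring.
Qed.

Lemma mem_hull (s : seq V) (x : V) : x \in s -> hull s x.
Proof.
move=> xs; have xi : (index x s < size s)%N by rewrite index_mem.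
exists (fun i => (i == Ordinal xi)%:R); split; [|split].
- by move=> i; rewrite ler0n.
- by rewrite (bigD1 (Ordinal xi))//= eqxx big1 ?addr0// => i /negPf ->.
rewrite (bigD1 (Ordinal xi))//= eqxx scale1r nth_index// big1 ?addr0//.
by move=> i /negPf ->; rewrite scale0r.
Qed.

(** Take [u = y - z0], where [z0] is the point of the hull nearest to [y]. Moving from [z0] towards
    a sample point cannot decrease the distance, which forces [dot u (x - z0) <= 0]. *)
Lemma hull_separation (s : seq V) (y : V) : s != [::] -> ~ hull s y ->
  exists u : V, forall x, x \in s -> dot u x < dot u y.
Proof.
case: s => // x0 s' _; set s := x0 :: s' => yK.
pose f (z : V) := \sum_i (y ord0 i - z ord0 i) * (y ord0 i - z ord0 i).
have fE z : f z = dot (y - z) (y - z).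
  by apply: eq_bigr => i _; rewrite !mxE.
have cf : continuous f.
  apply: (@continuous_sum_seq _ R^o) => i z.
  have c1 : {for z, continuous (fun z : V => y ord0 i - z ord0 i)}.
    apply: (@continuousB _ R^o _ (cst (y ord0 i))); first exact: cst_continuous.
    exact: coord_continuous.
  exact: (continuousM c1 c1).
have [z0 /set_mem Kz0 zmin] := compact_EVT_min (ex_intro _ _ (mem_hull (mem_head x0 s')))
  (@hull_compact s) (continuous_subspaceT cf).
exists (y - z0) => x xs.
have u0 : 0 < dot (y - z0) (y - z0).
  apply: dot_gt0; rewrite subr_eq0; apply/eqP => yz; apply: yK; rewrite yz; exact: Kz0.
set u := y - z0 in u0 *; pose w := x - z0.
suff a0 : dot u w <= 0.
  move: a0 u0; rewrite /w /u !dotDr !dotNr; lra.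
rewrite leNgt; apply/negP => a0.
set a := dot u w in a0; have := dot_ge0 w; set b := dot w w => b0.
(* The squared distance changes by [- 2 t a + t ^ 2 b]. The denominator [a + b], instead of the
   optimal [b], guarantees [t <= 1] and is nonzero; still [t b <= a], so the change would be
   negative. *)
pose t := a / (a + b).
have ab : 0 < a + b by rewrite ltr_wpDr.
have t0 : 0 < t by rewrite divr_gt0.
have t1 : t <= 1 by rewrite ler_pdivrMr// mul1r lerDl.
have Kt : hull s (z0 + t *: w).
  by apply: hull_convex => //; [rewrite ltW|exact: mem_hull].
have := zmin _ (mem_set Kt); rewrite !fE.
have -> : y - (z0 + t *: w) = u - t *: w by rewrite opprD addrA.
rewrite dot_subZ -/a -/b -/u -addrA lerDl addrC subr_ge0 => h.
have h2 : 2 * a <= t * b by rewrite -(ler_pM2l t0) mulrCA.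
have : t * b <= a.
  by rewrite /t mulrAC ler_pdivrMr// ler_wpM2l ?(ltW a0)// lerDr ltW.
lra.
Qed.

End dot_theory.

(** * Iterated integrals over independent samples *)

Section iter_int_theory.
Variables (R : realType) (n : nat).
Local Notation V := 'rV[R]_n.

(** The integral of a nonnegative function is a supremum over the simple functions below it, hence
    monotone as it stands. This spares every measurability proof for the nested integrands of
    [iter_int]. *)
Lemma ge0_le_integral_nonmeasurable d (T : measurableType d)
    (m : {measure set T -> \bar R}) (f g : T -> \bar R) :
  (forall x, 0 <= f x)%E -> (forall x, f x <= g x)%E ->
  (\int[m]_x f x <= \int[m]_x g x)%E.
Proof.
move=> f0 fg; have g0 x : (0 <= g x)%E by exact: le_trans (fg x).
rewrite !ge0_integralTE//; apply: le_ereal_sup => _ [h hf <-].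
by exists h => // x; exact: le_trans (fg x).
Qed.

Variable mu : probability (borelRn R n) R.

Lemma iter_int_ge0 N (F : seq V -> \bar R) :
  (forall s, 0 <= F s)%E -> (0 <= iter_int mu N F)%E.
Proof.
elim: N F => [|N IH] F F0 /=; first exact: F0.
by apply: integral_ge0 => x _; exact: IH.
Qed.

Lemma le_iter_int N (F G : seq V -> \bar R) :
  (forall s, 0 <= F s)%E -> (forall s, F s <= G s)%E ->
  (iter_int mu N F <= iter_int mu N G)%E.
Proof.
elim: N F G => [|N IH] F G F0 FG /=; first exact: FG.
apply: ge0_le_integral_nonmeasurable => x; last exact: IH.
exact: iter_int_ge0.
Qed.

Lemma iter_int_cst N (c : R) : iter_int mu N (fun=> c%:E) = c%:E.
Proof.
elim: N => [//|N IH] /=; under eq_integral do rewrite IH.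
rewrite integral_cst// [X in (_ * X)%E](_ : _ = 1%E) ?mule1//.
exact: probability_setT.
Qed.

Definition hits (I : finType) (B : I -> set V) (D : {set I}) (s : seq V) : bool :=
  [forall i in D, has (fun x => x \in B i) s].

Lemma iter_int_hits (I : finType) (B : I -> set V) (c : R) (N : nat) (D : {set I}) :
  (forall i, measurable (B i : set (borelRn R n))) -> 0 <= c <= 1 ->
  ((c - \sum_(i in D) (1 - fine (mu (B i))) ^+ N)%:E <=
   iter_int mu N (fun s => (if hits B D s then c else 0)%:E))%E.
Proof.
move=> mB /andP[c0 c1]; elim: N D => [|N IH] D.
  rewrite /= lee_fin; case: ifPn => hD.
    by rewrite gerBl sumr_ge0// => i _; rewrite expr0.
  (* With no point drawn, failure means that [D] is nonempty; each term of the sum is then a zeroth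
     power, equal to 1, and already at least [c]. *)
  have [D0|[i iD]] := set_0Vmem D.
    by move: hD; rewrite /hits D0; case/negP; apply/forallP => i; rewrite inE.
  rewrite subr_le0 (bigD1 i)//= expr0 (le_trans c1)// lerDl.
  by apply: sumr_ge0 => j _; rewrite expr0.
rewrite [X in (_ <= X)%E]/=.
pose q i := 1 - fine (mu (B i)).
pose phi x : R := c - \sum_(i in D) (\1_(~` B i) x : R) * q i ^+ N.
have finB i : mu (B i) \is a fin_num by exact: fin_num_measure.
have mBc i : measurable (~` B i : set (borelRn R n)) by exact: measurableC.
have muBc i : mu (~` B i) = (q i)%:E.
  by rewrite probability_setC// -(fineK (finB i)) -EFinB.
have step x : ((phi x)%:E <= iter_int mu N (fun s => (if hits B D (x :: s) then c else 0)%:E))%E.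
  pose D' := [set i in D | x \notin B i].
  have -> : (fun s => (if hits B D (x :: s) then c else 0)%:E) =
            (fun s => (if hits B D' s then c else 0)%:E).
    apply/funext => s; congr (if _ then _ else _)%:E.
    apply/forall_inP/forall_inP => h i; rewrite ?inE => iD; last first.
      have [xB|xB] := boolP (x \in B i); first by rewrite /= xB.
      by rewrite /= h ?orbT// inE iD.
    by case/andP: iD => iD /negPf xB; have := h i iD; rewrite /= xB.
  apply: le_trans (IH D'); rewrite lee_fin /phi lerD2l lerN2.
  rewrite [leLHS](_ : _ = \sum_(i in D) (\1_(~` B i) x : R) * q i ^+ N)//.
  rewrite big_mkcond [RHS]big_mkcond; apply: eq_bigr => i _; rewrite inE indicE.
  case: (i \in D) => //=; rewrite in_setC; case: (x \in B i) => /=.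
    by rewrite mul0r.
  by rewrite mul1r.
(* The bound [phi] may be negative, while monotonicity is available for nonnegative integrands only,
   so the comparison goes through the positive part of [phi]. *)
apply: (@le_trans _ _ (\int[mu]_x (Num.max (phi x) 0)%:E)%E); last first.
  apply: ge0_le_integral_nonmeasurable => x; first by rewrite lee_fin le_max lexx orbT.
  rewrite maxEle; case: ifP => _; last exact: step.
  by apply: iter_int_ge0 => s; rewrite lee_fin; case: ifP.
have intB i : mu.-integrable setT (fun x : borelRn R n => ((\1_(~` B i) x : R) * q i ^+ N)%:E).
  under eq_fun do rewrite mulrC EFinM.
  by apply: integrableZl => //; exact: integrable_indic.
have intS : mu.-integrable setT (fun x : borelRn R n =>
    (\sum_(i in D) (\1_(~` B i) x : R) * q i ^+ N)%:E).
  rewrite (_ : (fun x => _) = fun x => \sum_(i in D) ((\1_(~` B i) x : R) * q i ^+ N)%:E)%E.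
    exact: integrable_sum.
  by apply/funext => x; rewrite sumEFin.
have intphi : mu.-integrable setT (fun x : borelRn R n => (phi x)%:E).
  have := integrableB measurableT (finite_measure_integrable_cst mu c measurableT) intS.
  by apply: eq_integrable => // x _.
have intmax : mu.-integrable setT (fun x : borelRn R n => (Num.max (phi x) 0)%:E).
  have := integrable_funepos measurableT intphi; apply: eq_integrable => // x _.
  by rewrite funeposE EFin_max.
apply: (@le_trans _ _ (\int[mu]_x (phi x)%:E)%E); last first.
  by apply: le_integral => // x _; rewrite lee_fin le_max lexx.
rewrite le_eqVlt; apply/orP; left; apply/eqP.
rewrite /phi (integralB_EFin measurableT (f1 := fun=> c))//; last first.
  exact: finite_measure_integrable_cst.
rewrite EFinB; congr (_ - _)%E.
  by rewrite -[LHS](iter_int_cst 1 c).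
under [RHS]eq_integral do rewrite -sumEFin.
rewrite integral_sum// -sumEFin; apply: eq_bigr => i _.
under eq_integral do rewrite EFinM.
rewrite integralZr//; last exact: integrable_indic.
rewrite integral_indic// [X in (X * _)%E](_ : _ = (q i)%:E).
  by rewrite -EFinM -exprS.
by rewrite -(muBc i); congr (mu _); rewrite setIT.
Qed.

End iter_int_theory.

(** * Bases of near-maximal determinant *)

Section near_auerbach.
Variables (R : realType) (n : nat).
Local Notation V := 'rV[R]_n.
Variable N : V -> R.
Hypothesis ND : forall u v, N (u + v) <= N u + N v.
Hypothesis NZ : forall a u, N (a *: u) = `|a| * N u.
Hypothesis N_gt0 : forall u, u != 0 -> 0 < N u.

Let N0 : N 0 = 0.
Proof. by rewrite -(scale0r 0) NZ normr0 mul0r. Qed.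

Let N_ge0 u : 0 <= N u.
Proof. by have [->|/N_gt0/ltW//] := eqVneq u 0; rewrite N0. Qed.

Let K := \sum_(i < n) N (delta_mx ord0 i).

Let N_le_norm u : N u <= K * `|u|.
Proof.
rewrite {1}(row_sum_delta u) /K mulr_suml.
elim/big_ind2 : _ => [|x1 x2 y1 y2 h1 h2|i _].
- by rewrite N0.
- exact: le_trans (ND _ _) (lerD h1 h2).
- by rewrite NZ mulrC ler_wpM2l// norm_coord_le.
Qed.

Let K_ge0 : 0 <= K.
Proof. by apply: sumr_ge0 => i _. Qed.

Let N_dist u v : `|N u - N v| <= N (u - v).
Proof.
have h (x y : V) : N x - N y <= N (x - y).
  by rewrite lerBlDr -{1}(subrK y x) ND.
rewrite ler_norml h andbT lerNl opprB (le_trans (h v u))//.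
by rewrite -opprB -scaleN1r NZ normrN1 mul1r.
Qed.

Let N_continuous : continuous N.
Proof.
move=> u A /nbhs_ballP[e /= e0 ueA]; apply/nbhs_ballP.
have K1 : 0 < K + 1 by rewrite ltr_wpDl.
exists (e / (K + 1)); first by rewrite /= divr_gt0.
move=> v uv; apply: ueA; rewrite /ball/=.
have {}uv : `|u - v| < e / (K + 1) by move: uv; rewrite -ball_normE.
apply: le_lt_trans (N_dist u v) _; apply: le_lt_trans (N_le_norm _) _.
move: uv; rewrite ltr_pdivlMr// => uv; apply: le_lt_trans uv.
by rewrite mulrC ler_wpM2l// lerDl.
Qed.

(** On the compact unit sphere of the sup norm the continuous function [N] attains a positive
    minimum. *)
Let N_lower : exists2 c : R, 0 < c & forall (u : V) (i : 'I_n), c * `|u ord0 i| <= N u.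
Proof.
have [i0|no] := pselect (exists i : 'I_n, True); last first.
  by exists 1 => // u i; exfalso; apply: no; exists i.
have cS : compact [set u : V | `|u| = 1].
  apply: (@compact_closed_bounded_rV _ _ _ 1) => [|u u1 i]; last first.
    by rewrite -u1 norm_coord_le.
  apply: (@preimage_closed _ _ (fun u : V => `|u|) [set 1]); last exact: closed_eq.
  by move=> u _; exact: norm_continuous.
have [i _] := i0.
have d0 : (delta_mx ord0 i : V) != 0.
  by apply/eqP => /rowP/(_ i); rewrite !mxE !eqxx => /eqP; rewrite oner_eq0.
have unit1 (u : V) : u != 0 -> `|(`|u|^-1 *: u)| = 1.
  by move=> u0; rewrite normrZ normfV normr_id mulVf// normr_eq0.
have [u0 /set_mem u01 umin] := compact_EVT_min (ex_intro _ _ (unit1 _ d0)) cS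
   (continuous_subspaceT N_continuous).
exists (N u0).
  by apply: N_gt0; apply/eqP => u00; move: u01; rewrite u00 /= normr0 => /eqP; rewrite eq_sym oner_eq0.
move=> u j; have [->|u_neq0] := eqVneq u 0; first by rewrite mxE normr0 mulr0.
have := umin _ (mem_set (unit1 _ u_neq0)).
have nu : 0 < `|u| by rewrite normr_gt0.
rewrite NZ ger0_norm ?invr_ge0// ler_pdivlMl// => h.
apply: le_trans h; rewrite mulrC ler_wpM2r//; exact: norm_coord_le.
Qed.

(** Choose [L] with rows in the unit ball of [N] and [|det L|] above half the supremum. Replacing
    row [j] by [a *m L] normalized multiplies the determinant by [a_j / N (a *m L)], and the result
    is still at most the supremum. The factor 2 is the price of near-maximality. *)
Lemma near_auerbach : exists2 L : 'M[R]_n, L \in unitmx &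
  (forall i, N (row i L) <= 1) /\
  (forall (a : V) j, `|a ord0 j| <= 2 * N (a *m L)).
Proof.
have [c c0 Nc] := N_lower.
pose S := [set `|\det L| | L in [set L : 'M[R]_n | forall i, N (row i L) <= 1]].
have a0 : 0 < (1 + K)^-1 by rewrite invr_gt0 ltr_pwDl.
(* A small scalar matrix is admissible, so the supremum is positive and the near-maximal [L] is
   invertible. *)
have S_gt0 : exists2 s, S s & 0 < s.
  exists `|\det ((1 + K)^-1%:M : 'M[R]_n)|.
    exists ((1 + K)^-1%:M) => //= i.
    rewrite rowE mul_mx_scalar NZ ger0_norm ?(ltW a0)// ler_pdivrMl ?ltr_pwDl// mulr1.
    by rewrite /K (bigD1 i)//= addrCA lerDl addr_ge0// sumr_ge0.
  by rewrite normr_gt0 det_scalar expf_neq0// gt_eqF.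
have [s1 Ss1 s10] := S_gt0.
have hS : has_sup S.
  split; first by exists s1.
  (* By [N_lower] every entry of an admissible matrix is at most [c^-1] in absolute value; the
     Leibniz formula then bounds the determinant. *)
  exists (\sum_(s : {perm 'I_n}) \prod_(i < n) c^-1) => _ [L NL <-].
  apply: le_trans (ler_norm_sum _ _ _) _; apply: ler_sum => s _.
  rewrite normrM normr_sign mul1r normr_prod; apply: ler_prod => i _.
  rewrite normr_ge0/= -[leRHS]mulr1 ler_pdivlMl//.
  by apply: le_trans (NL i); have := Nc (row i L) (s i); rewrite mxE.
have s0 : 0 < sup S by apply: lt_le_trans s10 _; apply: ub_le_sup; case: hS.
have s02 : 0 < sup S / 2 by rewrite divr_gt0.
have [_ [L NL <-] dL] := sup_adherent s02 hS.
have {}dL : sup S < 2 * `|\det L| by lra.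
have dL0 : \det L != 0 by rewrite -normr_gt0; lra.
exists L; first by rewrite unitmxE unitfE.
split => // a j.
have [wz|w0] := eqVneq (a *m L) 0.
  have : a *m L *m invmx L = 0 by rewrite wz mul0mx.
  by rewrite mulmxK ?unitmxE ?unitfE// => ->; rewrite mxE normr0 mulr_ge0.
have nw : 0 < N (a *m L) by exact: N_gt0.
have [w wE] : exists w, w = (N (a *m L))^-1 *: (a *m L) by eexists.
pose L' : 'M[R]_n := \matrix_(i, k) (if i == j then w ord0 k else L i k).
have rowL' i : row i L' = if i == j then w else row i L.
  by apply/rowP => k; rewrite !mxE; case: ifP => // _; rewrite mxE.
have SL' : S `|\det L'|.
  exists L' => // i; rewrite rowL'; case: ifP => _; last exact: NL.
  by rewrite wE NZ ger0_norm ?invr_ge0// mulVf// gt_eqF.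
(* Expand along row [j]: the cofactors are those of [L], and [L *m \adj L] is the scalar matrix
   [\det L]. *)
have detL' : \det L' = (N (a *m L))^-1 * a ord0 j * \det L.
  rewrite (expand_det_row L' j).
  transitivity ((w *m \adj L) ord0 j).
    rewrite [RHS]mxE; apply: eq_bigr => k _; rewrite !mxE eqxx; congr (_ * _).
    congr (_ * \det _); apply/matrixP => i l; rewrite !mxE.
    by rewrite eq_sym (negPf (neq_lift _ _)).
  rewrite wE -scalemxAl -mulmxA mul_mx_adj mul_mx_scalar !mxE; ring.
have : `|\det L'| <= sup S by apply: ub_le_sup; case: hS.
rewrite detL' !normrM ger0_norm ?invr_ge0// => h.
have : (N (a *m L))^-1 * `|a ord0 j| * `|\det L| < 2 * `|\det L| by exact: le_lt_trans dL.
by rewrite ltr_pM2r ?normr_gt0// ltr_pdivrMl// mulrC => /ltW.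
Qed.

End near_auerbach.

(** * Tail estimates *)

Section tails.
Context d (T : measurableType d) (R : realType) (P : probability T R).
Implicit Types f : T -> R.

Lemma measurable_superlevel f (t : R) : measurable_fun setT f ->
  measurable [set x | t <= f x].
Proof.
by move=> mf; rewrite -[X in measurable X]setTI; exact: measurable_fun_ler.
Qed.

Lemma markov_superlevel f (e t : R) : measurable_fun setT f -> (forall x, 0 <= f x) ->
  (\int[P]_x (f x)%:E <= e%:E)%E -> 0 < t ->
  (P [set x | (t <= f x)%R] <= (e / t)%:E)%E.
Proof.
move=> mf f0 fe t0.
have mEf : measurable_fun setT (EFin \o f) by exact/measurable_EFinP.
have := @le_integral_abse _ _ _ P setT measurableT (EFin \o f) t mEf t0.
have -> : setT `&` [set x | (t%:E <= `|(EFin \o f) x|)%E] = [set x | t <= f x].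
  by apply/seteqP; split => [x [_]|x] /=; rewrite lee_fin ger0_norm.
have -> : (\int[P]_x `|(EFin \o f) x| = \int[P]_x (f x)%:E)%E.
  by apply: eq_integral => x _ /=; rewrite ger0_norm.
move=> /le_trans/(_ fe).
have mA : measurable [set x | t <= f x] by exact: measurable_superlevel.
by rewrite mulrC EFinM lee_pdivlMl.
Qed.

(** On [A K] the function [f] is at most [K rho] plus [rho] times the number of sets [A (K + k)],
    [k >= 0], that contain the point. The tails then sum to a geometric series of total
    [2 rho / 2 ^+ K]. *)
Lemma truncated_expectation f (rho : R) (K : nat) : measurable_fun setT f ->
  (forall x, 0 <= f x) -> 0 < rho -> (0 < K)%N ->
  (forall k : nat, (0 < k)%N -> (P [set x | (k%:R * rho <= f x)%R] <= ((2 ^+ k)^-1)%:E)%E) ->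
  (\int[P]_x (f x * (\1_[set x | (K%:R * rho <= f x)%R] x))%:E <=
     (rho * (K%:R + 2) / 2 ^+ K)%:E)%E.
Proof.
move=> mf f0 r0 K0 tail.
pose A (k : nat) := [set x | k%:R * rho <= f x].
have mA k : measurable (A k) by exact: measurable_superlevel.
pose g0 x : \bar R := (K%:R * rho * \1_(A K) x)%:E.
pose g (k : nat) x : \bar R := (rho * \1_(A (K + k)%N) x)%:E.
have ind0 (B : set T) x : 0 <= (\1_B x : R) by rewrite indicE ler0n.
have g00 x : (0 <= g0 x)%E by rewrite lee_fin mulr_ge0// mulr_ge0// ltW.
have gk0 k x : (0 <= g k x)%E by rewrite lee_fin mulr_ge0// ltW.
have mg0 : measurable_fun setT g0.
  by apply/measurable_EFinP; apply: measurable_funM.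
have mg k : measurable_fun setT (g k).
  by apply/measurable_EFinP; apply: measurable_funM.
have mS : measurable_fun setT (fun x => \sum_(k <oo) g k x)%E.
  by apply: ge0_emeasurable_sum => *; [exact: gk0|exact: mg].
have S0 x : (0 <= \sum_(k <oo) g k x)%E by apply: nneseries_ge0.
apply: (@le_trans _ _ (\int[P]_x (g0 x + \sum_(k <oo) g k x))%E).
  apply: ge0_le_integral_nonmeasurable => x; first by rewrite lee_fin mulr_ge0.
  rewrite indicE; have [xA|xA] := boolP (x \in _); last first.
    by rewrite mulr0 adde_ge0.
  rewrite mulr1 /g0 /A indicE xA mulr1.
  have /= KA := set_mem xA.
  (* The point lies in [A K], ..., [A j], which are [j - K + 1] sets, so the bound is at least
     [(j + 1) rho], which exceeds [f x]. *)
  pose j := Num.truncn (f x / rho).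
  have jf : j%:R * rho <= f x by rewrite -ler_pdivlMr// truncn_le// divr_ge0// ltW.
  have fj : f x < j.+1%:R * rho by rewrite -ltr_pdivrMr// truncnS_gt.
  have Kj : (K <= j)%N.
    by rewrite -ltnS -(ltr_nat R) -(ltr_pM2r r0); exact: le_lt_trans fj.
  apply: le_trans (leeD2l _ (nneseries_lim_ge (j - K).+1 _)); last by move=> *; exact: gk0.
  rewrite big_mkord (eq_bigr (fun=> rho%:E)); last first.
    move=> i _; rewrite /g indicE mem_set ?mulr1//=.
    apply: le_trans jf; rewrite ler_pM2r// ler_nat.
    by have := leq_ord i; rewrite leq_subRL.
  rewrite sumEFin sumr_const card_ord -EFinD lee_fin -[rho *+ _]mulr_natl -mulrDl -natrD.
  by rewrite addnS subnKC// ltW.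
rewrite ge0_integralD// integral_nneseries//.
have Ind (c : R) B : measurable B -> (\int[P]_x (c * \1_B x)%:E = c%:E * P B)%E.
  move=> mB; under eq_integral do rewrite EFinM.
  rewrite integralZl//; last exact: integrable_indic.
  by rewrite integral_indic// setIT.
have Ig0 : (\int[P]_x g0 x <= (K%:R * rho / 2 ^+ K)%:E)%E.
  rewrite /g0 Ind// [leRHS]EFinM lee_wpmul2l//.
    by rewrite lee_fin mulr_ge0// ltW.
  exact: tail.
have Ig k : (\int[P]_x g k x <= (2 * rho / 2 ^+ K / (2 ^ k.+1)%:R)%:E)%E.
  rewrite /g Ind//.
  have -> : 2 * rho / 2 ^+ K / (2 ^ k.+1)%:R = rho * (2 ^+ (K + k))^-1.
    by rewrite natrX exprS exprD; field; rewrite !expf_neq0.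
  rewrite EFinM; apply: lee_wpmul2l; first by rewrite lee_fin ltW.
  by apply: tail; rewrite addn_gt0 K0.
apply: (@le_trans _ _ ((K%:R * rho / 2 ^+ K)%:E + (2 * rho / 2 ^+ K)%:E)%E).
  apply: leeD => //.
  apply: le_trans (epsilon_trick0 xpredT _); last by rewrite !mulr_ge0 ?invr_ge0 ?exprn_ge0// ltW.
  by apply: lee_nneseries => // k _ _; apply: integral_ge0 => x _; exact: gk0.
by rewrite -EFinD lee_fin; rewrite le_eqVlt; apply/orP; left; apply/eqP; field; rewrite expf_neq0.
Qed.

End tails.

(** * First absolute moments of linear functionals *)

Section first_moment.
Variables (R : realType) (n : nat) (mu : probability (borelRn R n) R).
Local Notation V := 'rV[R]_n.
Hypothesis bar : barycenter0 mu.

Lemma measurable_dot (u : V) : measurable_fun setT (dot u : borelRn R n -> R).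
Proof. apply: continuous_measurable_rV; exact: continuous_dot. Qed.

Let intc i (a : R) : mu.-integrable setT (fun x : borelRn R n => (x ord0 i * a)%:E).
Proof.
under eq_fun do rewrite mulrC EFinM.
by apply: integrableZl => //; case: (bar i).
Qed.

Lemma integrable_dot (u : V) :
  mu.-integrable setT (fun x : borelRn R n => (dot u x)%:E).
Proof.
rewrite /dot; under eq_fun do rewrite -sumEFin.
exact: integrable_sum.
Qed.

Lemma integral_dot (u : V) : (\int[mu]_x (dot u x)%:E = 0)%E.
Proof.
rewrite /dot; under eq_integral do rewrite -sumEFin.
rewrite integral_sum//; apply: big1 => i _.
under eq_integral do rewrite mulrC EFinM.
by have [ib Ib] := bar i; rewrite integralZl// Ib mule0.
Qed.

Lemma integrable_norm_dot (u : V) :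
  mu.-integrable setT (fun x : borelRn R n => `|dot u x|%:E).
Proof. by have := integrable_norm (integrable_dot u). Qed.

Definition first_moment (u : V) : R := fine (\int[mu]_x `|dot u x|%:E).

Lemma first_momentE (u : V) : (\int[mu]_x `|dot u x|%:E = (first_moment u)%:E)%E.
Proof. by rewrite fineK//; apply: integrable_fin_num => //; exact: integrable_norm_dot. Qed.

Lemma first_momentD (u v : V) : first_moment (u + v) <= first_moment u + first_moment v.
Proof.
rewrite -lee_fin EFinD -!first_momentE.
rewrite -integralD//; [|exact: integrable_norm_dot..].
apply: le_integral => //; first exact: integrable_norm_dot.
  by apply: (integrableD measurableT (integrable_norm_dot u) (integrable_norm_dot v)).
by move=> x _; rewrite -EFinD lee_fin dotDl ler_normD.
Qed.

Lemma first_momentZ (a : R) (u : V) : first_moment (a *: u) = `|a| * first_moment u.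
Proof.
apply: EFin_inj; rewrite EFinM -!first_momentE -integralZl//; last exact: integrable_norm_dot.
by apply: eq_integral => x _; rewrite dotZl normrM EFinM.
Qed.

(** A vanishing first moment would make [dot u] zero almost everywhere, and its zero set would be a
    hyperplane of full measure. *)
Lemma first_moment_gt0 (u : V) : (forall H, hyperplane H -> (mu H < 1)%E) ->
  u != 0 -> 0 < first_moment u.
Proof.
move=> hyp u0; rewrite lt_neqAle; apply/andP; split; last first.
  by rewrite fine_ge0//; apply: integral_ge0 => x _; rewrite lee_fin.
apply/eqP => N0.
have hH : hyperplane [set x | dot u x = 0] by exists u, 0.
have mH : measurable ([set x | dot u x = 0] : set (borelRn R n)).
  apply: closed_measurable_rV; apply: (@preimage_closed _ _ (dot u) [set 0]).
    by move=> x _; exact: continuous_dot.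
  exact: closed_eq.
have mE : measurable_fun setT (fun x : borelRn R n => (dot u x)%:E).
  by apply/measurable_EFinP; exact: measurable_dot.
have [Z [mZ Z0 ZH]] : ae_eq mu setT (fun x : borelRn R n => (dot u x)%:E) (cst 0%E).
  by apply/(ae_eq_integral_abs mu measurableT mE); rewrite first_momentE -N0.
have := hyp _ hH; apply/negP; rewrite -leNgt.
have : (mu (~` [set x | dot u x = 0%R]) <= 0)%E.
  rewrite -Z0; apply: le_measure; rewrite ?inE//; first exact: measurableC.
  by apply: subset_trans ZH => x /= ux /(_ I) [].
by rewrite probability_setC// leeBlDr ?add0e// fin_num_measure.
Qed.

End first_moment.

(** * Borell's exponential tail bound for a norm *)

Section borell.
Variables (R : realType) (n : nat) (mu : probability (borelRn R n) R).
Local Notation V := 'rV[R]_n.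
Hypothesis lc : log_concave mu.
Variable phi : V -> R.
Hypothesis phi_ge0 : forall x, 0 <= phi x.
Hypothesis phiD : forall x y, phi (x + y) <= phi x + phi y.
Hypothesis phiZ : forall a x, phi (a *: x) = `|a| * phi x.
Hypothesis phi_cont : continuous phi.
Hypothesis phi_compact : forall t, compact [set x | phi x <= t].
Variable e : R.
Hypothesis e_gt0 : 0 < e.
Hypothesis phi_e : (\int[mu]_x (phi x)%:E <= e%:E)%E.

Let mphi : measurable_fun setT (phi : borelRn R n -> R).
Proof. exact: continuous_measurable_rV. Qed.

(** By Markov, [B = {phi <= 3 e}] has mass at least 2/3. With weight [l = 1 / k], combining a point
    where [phi >= 6 e k] with a point of [B] leaves [B], since [6 e - (1 - l) 3 e > 3 e].
    Log-concavity gives [p ^ l (2 / 3) <= 1 / 3] for the tail mass [p], hence [p <= 2 ^ (- k)]. *)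
Lemma borell_tail (k : nat) : (0 < k)%N ->
  (mu [set x | (k%:R * (6 * e) <= phi x)%R] <= ((2 ^+ k)^-1)%:E)%E.
Proof.
case: k => // k _.
pose r := 3 * e; have r0 : 0 < r by rewrite mulr_gt0.
pose rho := k.+1%:R * (6 * e).
have mge t : measurable ([set x | t <= phi x] : set (borelRn R n)).
  exact: (@measurable_superlevel _ (borelRn R n) R phi t mphi).
have mgt t : measurable ([set x | t < phi x] : set (borelRn R n)).
  by apply: open_measurable_rV; apply: (@open_comp _ _ phi [set y | t < y]) => //; exact: open_gt.
have phiN x : phi (- x) = phi x by rewrite -scaleN1r phiZ normrN1 mul1r.
have third : (mu [set x | (r < phi x)%R] <= (3^-1)%:E)%E.
  apply: (@le_trans _ _ (mu [set x | r <= phi x])).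
    by apply: le_measure; rewrite ?inE// => x /= /ltW.
  apply: le_trans (markov_superlevel mphi phi_ge0 phi_e r0) _.
  by rewrite lee_fin /r; rewrite le_eqVlt; apply/orP; left; apply/eqP; field; rewrite gt_eqF.
pose B := [set x | phi x <= r].
have mB : measurable (B : set (borelRn R n)).
  by apply: compact_measurable_rV; exact: phi_compact.
have muB : 2 / 3 <= fine (mu B).
  rewrite -lee_fin fineK ?fin_num_measure//.
  have -> : B = ~` [set x | r < phi x].
    apply/seteqP; split => x.
      by move=> h; apply/negP; rewrite -leNgt.
    by move=> /= /negP; rewrite -leNgt.
  rewrite probability_setC// (_ : (2 / 3)%:E = 1 - (3^-1)%:E)%E.
    by rewrite leeB.
  by rewrite -EFinB; congr (_%:E); field.
(* Log-concavity is assumed for compact sets only, so the tail is first cut at a level [t]. *)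
have key (t : R) : (mu [set x | (rho <= phi x <= t)%R] <= ((2 ^+ k.+1)^-1)%:E)%E.
  pose A := [set x | rho <= phi x <= t].
  have AE : A = [set x | phi x <= t] `&` [set x | rho <= phi x].
    apply/seteqP; split => [x /andP[]//|x [h1 h2]].
    by apply/andP; split.
  have cA : compact A.
    rewrite AE; apply: compact_closedI; first exact: phi_compact.
    apply: (@preimage_closed _ _ phi [set y | rho <= y]).
      by move=> x _; exact: phi_cont.
    exact: closed_ge.
  pose l : R := k.+1%:R^-1.
  (* For exponent 1 the weight would be [l = 1], which is excluded; Markov gives 1/6 directly. *)
  have [k0|k0] := posnP k.
    apply: (@le_trans _ _ (mu [set x | rho <= phi x])).
      apply: le_measure; rewrite ?inE//; first exact: compact_measurable_rV.
      by move=> x /= /andP[].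
    apply: le_trans (markov_superlevel mphi phi_ge0 phi_e _) _.
      by rewrite /rho !mulr_gt0.
    rewrite lee_fin /rho k0 mul1r expr1 invfM mulrCA divff ?gt_eqF// mulr1.
    by rewrite lef_pV2 ?posrE// ler_nat.
  have l01 : 0 < l < 1.
    by rewrite invr_gt0 ltr0n/= invf_lt1// ltr1n ltnS.
  have := lc.1 A B l cA (@phi_compact r) l01.
  have sub : mink_comb l A B `<=` [set x | r < phi x].
    move=> _ [x /andP[Ax _] [y By <-]] /=.
    have h1 : l * rho <= phi (l *: x).
      by rewrite phiZ ger0_norm ?(ltW (andP l01).1)// ler_pM2l//; case/andP: l01.
    have h2 : phi ((1 - l) *: y) <= (1 - l) * r.
      case/andP: l01 => l0 l1; rewrite phiZ ger0_norm ?subr_ge0 ?(ltW l1)//.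
      by rewrite ler_wpM2l// subr_ge0 ltW.
    have h3 : phi (l *: x) <= phi (l *: x + (1 - l) *: y) + phi ((1 - l) *: y).
      rewrite -{1}(addrK ((1 - l) *: y) (l *: x)); apply: le_trans (phiD _ _) _.
      by rewrite phiN.
    have lr : l * rho = 2 * r.
      rewrite /l /rho /r mulrA mulVf ?pnatr_eq0// mul1r; ring.
    have lr0 : 0 < l * r by rewrite mulr_gt0//; case/andP: l01.
    have : phi (l *: x) <= phi (l *: x + (1 - l) *: y) + (1 - l) * r by exact: le_trans h3 (lerD (lexx _) h2).
    move: h1; rewrite lr; lra.
  have mM : measurable (mink_comb l A B : set (borelRn R n)).
    apply: compact_measurable_rV; apply: compact_mink_comb => //; exact: phi_compact.
  move=> /le_trans/(_ (le_trans (le_measure mu _ _ sub) third)).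
  rewrite !inE lee_fin => /(_ mM (mgt _)) h.
  have finA : mu A \is a fin_num by apply: fin_num_measure; exact: compact_measurable_rV.
  rewrite -(fineK finA) lee_fin.
  set p := fine (mu A) in h *.
  have p0 : 0 <= p by exact: fine_ge0.
  (* Raising a number of []0, 1]] to the power [1 - l <= 1] does not decrease it. *)
  have hB : 2 / 3 <= powR (fine (mu B)) (1 - l).
    have finB : mu B \is a fin_num by exact: fin_num_measure.
    apply: (le_trans muB); rewrite -{1}[fine _]powRr1 ?fine_ge0//.
    apply: ger_powR; last by rewrite gerBl; case/andP: l01 => /ltW.
    apply/andP; split; first by apply: (lt_le_trans _ muB); rewrite divr_gt0.
    by rewrite -lee_fin fineK//; exact: probability_le1.
  have pl : powR p l <= 2^-1.
    have := ler_wpM2l (powR_ge0 p l) hB; lra.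
  have : powR (powR p l) k.+1%:R <= powR 2^-1 k.+1%:R.
    by apply: ge0_ler_powR => //; rewrite ?nnegrE ?powR_ge0 ?invr_ge0.
  by rewrite -powRrM mulVf ?pnatr_eq0// powRr1// powR_mulrn ?invr_ge0// exprVn.
have mA t : measurable ([set x | rho <= phi x <= t] : set (borelRn R n)).
  rewrite (_ : [set _ | _] = [set x | phi x <= t] `&` [set x | rho <= phi x]).
    by apply: measurableI => //; apply: compact_measurable_rV; exact: phi_compact.
  apply/seteqP; split => [x /andP[]//|x [h1 h2]].
  by apply/andP; split.
apply/lee_addgt0Pr => d d0.
(* The cut is placed where Markov bounds the discarded part by [d]. *)
pose t := e / d + 1.
have t0 : 0 < t by rewrite addr_gt0// divr_gt0.
have ed : e / t <= d.
  by rewrite ler_pdivrMr// /t mulrDr mulrCA divff ?gt_eqF// mulr1 mulr1 lerDl ltW.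
apply: (@le_trans _ _ (mu ([set x | rho <= phi x <= t] `|` [set x | t <= phi x]))).
  apply: le_measure; rewrite ?inE//.
    by apply: measurableU.
  by move=> x /= rx; have [xt|tx] := leP (phi x) t; [left; rewrite rx|right; rewrite ltW].
apply: le_trans (measureU2 _ _ _) _ => //.
apply: leeD; first exact: key.
apply: le_trans (markov_superlevel mphi phi_ge0 phi_e t0) _.
by rewrite lee_fin.
Qed.

End borell.

(** * Depth of halfspaces *)

Section l1_norm.
Variables (R : realType) (n : nat) (L : 'M[R]_n).
Local Notation V := 'rV[R]_n.

Definition l1norm (x : V) : R := \sum_(i < n) `|dot (row i L) x|.

Lemma l1norm_ge0 x : 0 <= l1norm x.
Proof. exact: sumr_ge0. Qed.

Lemma l1normD x y : l1norm (x + y) <= l1norm x + l1norm y.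
Proof.
rewrite /l1norm -big_split; apply: ler_sum => i _; rewrite dotDr; exact: ler_normD.
Qed.

Lemma l1normZ a x : l1norm (a *: x) = `|a| * l1norm x.
Proof. by rewrite /l1norm mulr_sumr; apply: eq_bigr => i _; rewrite dotZr normrM. Qed.

Lemma continuous_l1norm : continuous l1norm.
Proof.
apply: (@continuous_sum_seq R _ R^o) => i x.
apply: (@continuous_comp _ _ _ (dot (row i L)) (fun r : R => `|r|)).
  exact: continuous_dot.
exact: norm_continuous.
Qed.

Lemma dot_mulmx (a x : V) : dot (a *m L) x = \sum_i a ord0 i * dot (row i L) x.
Proof.
rewrite /dot; under eq_bigr do rewrite mxE mulr_sumr.
rewrite exchange_big; apply: eq_bigr => i _; rewrite mulr_sumr.
by apply: eq_bigr => j _; rewrite mxE mulrCA.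
Qed.

Lemma dot_le_l1norm (a x : V) (M : R) : (forall i, `|a ord0 i| <= M) ->
  `|dot (a *m L) x| <= M * l1norm x.
Proof.
move=> aM; rewrite dot_mulmx /l1norm mulr_sumr.
apply: le_trans (ler_norm_sum _ _ _) _; apply: ler_sum => i _.
by rewrite normrM ler_wpM2r.
Qed.

(** Since [L] is invertible, each coordinate is a combination of the functionals [dot (row i L)], so
    sublevel sets are bounded. *)
Lemma compact_l1norm t : L \in unitmx -> compact [set x | l1norm x <= t].
Proof.
move=> Lu.
pose M := \sum_(k < n) `|(delta_mx ord0 k : V) *m invmx L|.
apply: (@compact_closed_bounded_rV _ _ _ (M * t)) => [|x /= xt k].
  apply: (@preimage_closed _ _ l1norm [set y | y <= t]); last exact: closed_le.
  by move=> x _; exact: continuous_l1norm.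
have -> : x ord0 k = dot ((delta_mx ord0 k : V) *m invmx L *m L) x.
  rewrite mulmxKV// /dot (bigD1 k)//= mxE !eqxx mulr1 big1 ?addr0// => j jk.
  by rewrite mxE (negPf jk) andbF mulr0.
have M0 : 0 <= M by apply: sumr_ge0.
apply: (@le_trans _ _ (M * l1norm x)); last exact: ler_wpM2l.
apply: dot_le_l1norm => i; apply: le_trans (norm_coord_le _ _) _.
by rewrite /M (bigD1 k)//= lerDl sumr_ge0.
Qed.

End l1_norm.

Section depth.
Variables (R : realType) (n : nat) (mu : probability (borelRn R n) R).
Local Notation V := 'rV[R]_n.
Hypothesis lc : log_concave mu.
Hypothesis bar : barycenter0 mu.
Variable L : 'M[R]_n.
Hypothesis Lu : L \in unitmx.
Hypothesis L1 : forall i, first_moment mu (row i L) <= 1.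
Hypothesis L2 : forall (a : V) j, `|a ord0 j| <= 2 * first_moment mu (a *m L).
Hypothesis n0 : (0 < n)%N.

Let phi := l1norm L.
Let nR : 0 < n%:R :> R. Proof. by rewrite ltr0n. Qed.

Let mphi : measurable_fun setT (phi : borelRn R n -> R).
Proof. by apply: continuous_measurable_rV; exact: continuous_l1norm. Qed.

Let intphi : mu.-integrable setT (fun x : borelRn R n => (phi x)%:E).
Proof.
rewrite /phi /l1norm; under eq_fun do rewrite -sumEFin.
by apply: integrable_sum => // i _; exact: integrable_norm_dot.
Qed.

Lemma integral_l1norm : (\int[mu]_x (phi x)%:E <= n%:R%:E)%E.
Proof.
rewrite /phi /l1norm; under eq_integral do rewrite -sumEFin.
rewrite integral_sum//; last by move=> i; exact: integrable_norm_dot.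
under eq_bigr do rewrite first_momentE//.
rewrite sumEFin lee_fin; apply: le_trans (ler_sum _ (fun i _ => L1 i)) _.
by rewrite sumr_const card_ord.
Qed.

Lemma l1norm_tail (k : nat) : (0 < k)%N ->
  (mu [set x | (k%:R * (6 * n%:R) <= phi x)%R] <= ((2 ^+ k)^-1)%:E)%E.
Proof.
apply: borell_tail => //.
- exact: l1norm_ge0.
- exact: l1normD.
- exact: l1normZ.
- exact: continuous_l1norm.
- by move=> t; exact: compact_l1norm.
- exact: integral_l1norm.
Qed.

Lemma measurable_halfspace (u : V) (q : R) :
  measurable ([set x | q <= dot u x] : set (borelRn R n)).
Proof. exact: (@measurable_superlevel _ (borelRn R n) R (dot u) q (measurable_dot u)). Qed.

(** Centering makes the mean of [dot v x + |dot v x|] equal to [first_moment mu v], which is at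
    least 1/4. Integrating the bound [pos] gives [1/4 <= 1/16 + 12 n^2 mu(H) + 1/16], hence the
    constant 96. *)
Lemma halfspace_lower (a : V) j : (forall i, `|a ord0 i| <= 1) -> 2^-1 <= `|a ord0 j| ->
  6 * n%:R * (n%:R + 2) / 2 ^+ n <= 32^-1 :> R ->
  (((96 * n%:R ^+ 2)^-1 : R)%:E <= mu [set x | (32^-1 <= dot (a *m L) x)%R])%E.
Proof.
move=> a1 aj hn.
pose v := a *m L; pose H := [set x | 32^-1 <= dot v x].
have mH : measurable (H : set (borelRn R n)) by exact: measurable_halfspace.
pose rho : R := 6 * n%:R.
have rho0 : 0 < rho by rewrite mulr_gt0.
pose T := [set x | n%:R * rho <= phi x].
have mT : measurable (T : set (borelRn R n)).
  exact: (@measurable_superlevel _ (borelRn R n) R phi _ mphi).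
have tail := truncated_expectation mphi (@l1norm_ge0 R n L) rho0 n0 l1norm_tail.
have Nv : 4^-1 <= first_moment mu v by have := L2 a j; rewrite -/v; lra.
(* Three regions: on [T] use [phi]; on [H] outside [T] use [phi < n rho]; elsewhere
   [dot v x < 1/32], and the sum is at most 1/16. *)
have pos (x : V) : dot v x + `|dot v x| <=
    16^-1 + (2 * (n%:R * rho) * \1_H x + 2 * (phi x * \1_T x)).
  have vphi : `|dot v x| <= phi x by rewrite -[leRHS]mul1r; exact: dot_le_l1norm.
  have d1 := ler_norm (dot v x).
  have phi0 : 0 <= phi x := l1norm_ge0 L x.
  have nr0 : 0 <= n%:R * rho by rewrite mulr_ge0// ltW.
  rewrite !indicE; have [xT|xT] := boolP (x \in T).
    have h1 : 0 <= 2 * (n%:R * rho) * (x \in H)%:R by rewrite !mulr_ge0.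
    rewrite mulr1; move: (2 * (n%:R * rho) * (x \in H)%:R) h1 => w; lra.
  rewrite mulr0 mulr0 addr0.
  have {xT} : phi x < n%:R * rho.
    by rewrite ltNge; apply: contra xT => h; rewrite inE.
  have [xH|xH] := boolP (x \in H); first by rewrite mulr1; lra.
  have {xH} : dot v x < 32^-1.
    by rewrite ltNge; apply: contra xH => h; rewrite inE.
  rewrite mulr0 addr0 => h _.
  have [d0|d0] := leP 0 (dot v x); first by rewrite (ger0_norm d0); lra.
  by rewrite (ltr0_norm d0); lra.
have int1 : (\int[mu]_x (dot v x + `|dot v x|)%:E = (first_moment mu v)%:E)%E.
  under eq_integral do rewrite EFinD.
  rewrite integralD//; [|exact: integrable_dot|exact: integrable_norm_dot].
  by rewrite integral_dot// first_momentE// add0e.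
have intH : mu.-integrable setT (fun x : borelRn R n => (2 * (n%:R * rho) * \1_H x)%:E).
  under eq_fun do rewrite EFinM.
  by apply: integrableZl => //; exact: integrable_indic.
have mpT : measurable_fun setT ((fun x => phi x * \1_T x) : borelRn R n -> R).
  by apply: measurable_funM.
have intT : mu.-integrable setT (fun x : borelRn R n => (phi x * \1_T x)%:E).
  apply: le_integrable intphi => //; first exact/measurable_EFinP.
  move=> x _; rewrite lee_fin !ger0_norm ?l1norm_ge0//.
    rewrite ler_piMr ?l1norm_ge0// indicE lern1; exact: leq_b1.
  by rewrite mulr_ge0 ?l1norm_ge0// indicE.
have intT2 : mu.-integrable setT (fun x : borelRn R n => (2 * (phi x * \1_T x))%:E).
  by under eq_fun do rewrite EFinM; apply: integrableZl.
have int2 : (\int[mu]_x (16^-1 + (2 * (n%:R * rho) * \1_H x + 2 * (phi x * \1_T x)))%:E =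
   (16^-1)%:E + ((2 * (n%:R * rho))%:E * mu H + 2%:E * \int[mu]_x (phi x * \1_T x)%:E))%E.
  under eq_integral do rewrite EFinD EFinD.
  rewrite integralD//; last 2 first.
  - exact: finite_measure_integrable_cst.
  - exact: integrableD.
  rewrite integralD//; congr (_ + (_ + _))%E.
  - exact: (iter_int_cst mu 1).
  - under eq_integral do rewrite EFinM.
    rewrite integralZl//; last exact: integrable_indic.
    by rewrite integral_indic// setIT.
  - by under eq_integral do rewrite EFinM; rewrite integralZl.
have : ((first_moment mu v)%:E <= (16^-1)%:E + ((2 * (n%:R * rho))%:E * mu H +
   2%:E * \int[mu]_x (phi x * \1_T x)%:E))%E.
  rewrite -int1 -int2; apply: le_integral => //.
  - under eq_fun do rewrite EFinD.
    exact: (integrableD measurableT (integrable_dot bar v) (integrable_norm_dot bar v)).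
  - under eq_fun do rewrite EFinD EFinD.
    apply: (integrableD measurableT (finite_measure_integrable_cst mu 16^-1 measurableT)).
    exact: (integrableD measurableT intH intT2).
  - by move=> x _; rewrite lee_fin.
have finT := integrable_fin_num measurableT intT.
have finH : mu H \is a fin_num by exact: fin_num_measure.
move: tail; rewrite -/T -(fineK finT) -(fineK finH) -!EFinM -!EFinD !lee_fin.
move: (fine _) => I; move: (fine _) => p tail hI.
have {}tail : I <= 32^-1 by apply: le_trans tail _; rewrite /rho.
have hp : 16^-1 <= n%:R * rho * p by lra.
rewrite -[leLHS]mulr1 ler_pdivrMl//; last by rewrite mulr_gt0// exprn_gt0.
by move: hp; rewrite /rho; nra.
Qed.

(** Climb from [q0] in steps of [eta] until the mass first falls below [eps]; Markov for [|dot v x|]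
    shows that this happens. A step of positive length copes with possible atoms. *)
Lemma quantile (v : V) (eps eta q0 : R) : 0 < eps -> 0 < eta -> 0 < q0 ->
  (eps%:E <= mu [set x | (q0 <= dot v x)%R])%E ->
  exists q, [/\ q0 <= q, (eps%:E <= mu [set x | (q <= dot v x)%R])%E &
    (mu [set x | (q + eta <= dot v x)%R] <= eps%:E)%E].
Proof.
move=> e0 et0 q00 hq0; apply: contrapT => nq.
have all k : (eps%:E <= mu [set x | (q0 + eta *+ k <= dot v x)%R])%E.
  elim: k => [|k IH]; first by rewrite mulr0n addr0.
  rewrite leNgt; apply/negP => h; apply: nq; exists (q0 + eta *+ k); split => //.
    by rewrite lerDl mulrn_wge0// ltW.
  by rewrite -addrA -mulrSr ltW.
pose N := first_moment mu v.
have N0 : 0 <= N by rewrite fine_ge0// integral_ge0.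
have mn : measurable_fun setT ((fun x => `|dot v x|) : borelRn R n -> R).
  by apply: measurableT_comp => //; exact: measurable_dot.
pose k := (Num.truncn ((N / eps) / eta)).+1.
have kN : N / eps < eta *+ k.
  by rewrite -mulr_natr -ltr_pdivrMl// mulrC; exact: truncnS_gt.
have t0 : 0 < q0 + eta *+ k by rewrite ltr_pwDl// mulrn_wge0// ltW.
have hN : (\int[mu]_x `|dot v x|%:E <= N%:E)%E by rewrite first_momentE.
have := markov_superlevel mn (fun x => normr_ge0 _) hN t0.
apply/negP; rewrite -ltNge; apply: lt_le_trans (_ : (eps%:E <= _)%E).
  rewrite lte_fin ltr_pdivrMr// mulrC -ltr_pdivrMr//; apply: lt_trans kN _.
  by rewrite ltrDr.
apply: le_trans (all k) _; apply: le_measure; rewrite ?inE.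
- exact: measurable_halfspace.
- exact: (@measurable_superlevel _ (borelRn R n) R _ _ mn).
- by move=> x /= /le_trans; apply; exact: ler_norm.
Qed.

End depth.

(** * The net of directions *)

Section net.
Variables (R : realType) (n m : nat).
Hypothesis m1 : (1 < m)%N.
Local Notation V := 'rV[R]_n.
Local Notation net := {ffun 'I_n -> 'I_(2 * m).+1}.

Definition net_point (f : net) : V := \row_i ((f i)%:R / m%:R - 1).

Let m0 : 0 < m%:R :> R. Proof. by rewrite ltr0n ltnW. Qed.

Lemma net_point_le1 f i : `|net_point f ord0 i| <= 1.
Proof.
rewrite mxE ler_norml; apply/andP; split.
  by rewrite lerBrDr addNr divr_ge0// ltW.
rewrite lerBlDr ler_pdivrMr// -(natrD _ 1 1) -natrM ler_nat.
exact: leq_ord.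
Qed.

Lemma net_round (a : V) : (forall i, `|a ord0 i| <= 1) ->
  exists f : net, forall i, `|a ord0 i - net_point f ord0 i| <= m%:R^-1.
Proof.
move=> a1.
pose k i := Num.truncn ((a ord0 i + 1) * m%:R).
have ge0 i : 0 <= (a ord0 i + 1) * m%:R.
  by rewrite mulr_ge0 ?(ltW m0)//; have := a1 i; rewrite ler_norml => /andP[]; lra.
have k_le i : (k i)%:R <= (a ord0 i + 1) * m%:R by rewrite truncn_le.
have k_lt i : (a ord0 i + 1) * m%:R < (k i)%:R + 1 by rewrite natr1 truncnS_gt.
have k2 i : (k i < (2 * m).+1)%N.
  rewrite ltnS -(ler_nat R); apply: le_trans (k_le i) _; rewrite natrM ler_pM2r//.
  by have := a1 i; rewrite ler_norml => /andP[]; lra.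
exists [ffun i => Ordinal (k2 i)] => i; rewrite mxE ffunE /=.
have -> : a ord0 i - ((k i)%:R / m%:R - 1) = ((a ord0 i + 1) * m%:R - (k i)%:R) / m%:R.
  by field; rewrite gt_eqF.
rewrite ger0_norm; last by rewrite divr_ge0 ?(ltW m0)// subr_ge0.
by rewrite -[leRHS]mul1r ler_pM2r ?invr_gt0//; have := k_lt i; lra.
Qed.

(** Grid points near the origin are set aside, because [halfspace_lower] needs a coordinate of size
    at least 1/2. *)
Definition wide (f : net) : bool := [exists j, 2^-1 <= `|net_point f ord0 j| :> R].

Lemma net_round_wide (a : V) j : (forall i, `|a ord0 i| <= 1) -> `|a ord0 j| = 1 ->
  exists2 f : net, wide f & forall i, `|a ord0 i - net_point f ord0 i| <= m%:R^-1.
Proof.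
move=> a1 aj; have [f fa] := net_round a1; exists f => //.
apply/existsP; exists j.
have : `|a ord0 j| <= `|a ord0 j - net_point f ord0 j| + `|net_point f ord0 j|.
  by rewrite -{1}(subrK (net_point f ord0 j) (a ord0 j)) ler_normD.
have m2 : (m%:R^-1 : R) <= 2^-1 by rewrite lef_pV2 ?posrE// ler_nat.
have := fa j; rewrite aj => h1 h2.
by move: (m%:R^-1) m2 h1 => w; lra.
Qed.

Variable L : 'M[R]_n.
Hypothesis Lu : L \in unitmx.
Hypothesis n0 : (0 < n)%N.

(** If [x / (1 + delta)] were outside the hull, a functional [u] would separate it from the sample.
    Normalize the coefficients of [u] in the basis [L] to sup norm 1 and round them to a wide grid
    point [f]; the sample point [z] for [f] contradicts the separation. *)
Lemma net_cover (delta r eta c : R) (q : net -> R) (s : seq V) (x : V) :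
  0 < delta -> 0 <= r ->
  (forall f, wide f -> c <= q f) ->
  eta + (2 + delta) * (r / m%:R) <= delta * c ->
  (forall f, wide f -> exists2 z, z \in s &
     q f <= dot (net_point f *m L) z /\ l1norm L z <= r) ->
  (forall f, wide f -> dot (net_point f *m L) x < q f + eta) ->
  l1norm L x <= r ->
  scale_set (1 + delta) (hull s) x.
Proof.
move=> d0 r0 qc hc hit xq xr.
have d1 : 0 < 1 + delta by rewrite addr_gt0.
(* The all-ones vector rounds to a wide grid point, whose hitting condition already provides a
   sample point. *)
have s0 : s != [::].
  have c1 i : `|(const_mx 1 : V) ord0 i| = 1 by rewrite mxE normr1.
  have c1' i : `|(const_mx 1 : V) ord0 i| <= 1 by rewrite c1.
  have [f wf _] := net_round_wide c1' (c1 (Ordinal n0)).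
  by have [z] := hit f wf; case: s {hit}.
pose y := (1 + delta)^-1 *: x.
suff : hull s y.
  by move=> hy; exists y => //; rewrite scalerA divff ?scale1r// gt_eqF.
apply: contrapT => yK; have [u usep] := hull_separation s0 yK.
have xE v : dot v x = (1 + delta) * dot v y.
  by rewrite dotZr mulrA divff ?mul1r// gt_eqF.
have [b ub] : exists b, u = b *m L by exists (u *m invmx L); rewrite mulmxKV.
have b0 : b != 0.
  apply/eqP => b0; case: s s0 usep {hit yK} => // z s' _ /(_ z (mem_head _ _)).
  have z0 w : dot u w = 0 by rewrite ub b0 mul0mx /dot big1// => i _; rewrite mxE mulr0.
  by rewrite !z0 ltxx.
have nb : 0 < `|b| by rewrite normr_gt0.
have [[i0 j] /= bj] : exists i, `|b| = `|b i.1 i.2|.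
  by apply: mx_norm_neq0; rewrite -/(Num.norm b) gt_eqF.
rewrite (ord1 i0) in bj.
pose a := `|b|^-1 *: b.
have ai i : `|a ord0 i| = `|b|^-1 * `|b ord0 i|.
  by rewrite mxE normrM normfV normr_id.
have [f wf fa] := @net_round_wide a j
  (fun i => ltac:(by rewrite ai ler_pdivrMl// mulr1 norm_coord_le))
  ltac:(by rewrite ai -bj mulVf// gt_eqF).
have aE w : dot (a *m L) w = `|b|^-1 * dot u w by rewrite -scalemxAl dotZl ub.
have near w : `|dot (a *m L) w - dot (net_point f *m L) w| <= m%:R^-1 * l1norm L w.
  rewrite -dotNl -dotDl -mulmxBl; apply: dot_le_l1norm => i.
  by rewrite !mxE; have := fa i; rewrite !mxE.
have nearr w : l1norm L w <= r ->
    `|dot (a *m L) w - dot (net_point f *m L) w| <= r / m%:R.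
  by move=> wr; apply: le_trans (near w) _; rewrite mulrC ler_pM2r ?invr_gt0.
have [z zs [zq zr]] := hit f wf.
have sep : (1 + delta) * dot (a *m L) z < dot (a *m L) x.
  by rewrite (xE (a *m L)) ltr_pM2l// !aE ltr_pM2l ?invr_gt0// usep.
have := nearr x xr; have := nearr z zr; rewrite !ler_norml.
have := xq f wf; have := qc f wf.
move: (dot (a *m L) x) (dot (a *m L) z) (dot (net_point f *m L) x)
  (dot (net_point f *m L) z) (r / m%:R) sep zq hc.
(* Rounding costs [e] at [x] and at [z]: [vx >= ax - e > (1 + delta) az - e >= (1 + delta) (q f - e)
   - e]. As [q f >= c], this is at least [q f + delta c - (2 + delta) e], hence at least
   [q f + eta]. *)
move=> ax az vx vz e sep zq hc cq xq' /andP[h1 h2] /andP[h3 h4].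
have h5 : (1 + delta) * (q f - e) <= (1 + delta) * az by rewrite ler_pM2l//; lra.
have h6 : delta * c <= delta * q f by rewrite ler_pM2l.
nra.
Qed.

End net.

Lemma measure_bigsetU_le d (T : measurableType d) (R : realType)
    (mu : {measure set T -> \bar R}) (I : Type) (r : seq I) (A : I -> set T) :
  (forall i, measurable (A i)) ->
  (mu (\big[setU/set0]_(i <- r) A i) <= \sum_(i <- r) mu (A i))%E.
Proof.
move=> mA; elim: r => [|i r IH]; first by rewrite !big_nil measure0.
rewrite !big_cons; apply: le_trans (measureU2 _ _ _) _ => //.
  exact: bigsetU_measurable.
by rewrite leeD2l.
Qed.

(** * Lower bound on the expected cover with free parameters *)

Section expected_cover_lower.
Variables (R : realType) (n : nat) (mu : probability (borelRn R n) R).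
Local Notation V := 'rV[R]_n.
Hypothesis lc : log_concave mu.
Hypothesis bar : barycenter0 mu.

(** The three losses are the mass where [l1norm] is large, the mass [eps] beyond each of at most [M]
    shifted halfspaces, and the probability that one of the [M] target sets receives no sample
    point. *)
Lemma expected_cover_ge (m K N : nat) (delta eps : R)
    (M := (((2 * m).+1 ^ n)%N)%:R : R) :
  (0 < n)%N -> (1 < m)%N -> (0 < K)%N -> 0 < delta < 1 -> 0 < eps ->
  6 * n%:R * (n%:R + 2) / 2 ^+ n <= 32^-1 :> R ->
  eps <= (96 * n%:R ^+ 2)^-1 ->
  (2 ^+ K)^-1 <= eps / 2 ->
  4 * (K%:R * (6 * n%:R) / m%:R) <= delta / 32 ->
  ((1 - (2 ^+ K)^-1 - M * eps - M * (1 - eps / 2) ^+ N)%:E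
    <= expected_cover mu delta N)%E.
Proof.
move=> n0 m1 K0 /andP[d0 d1] e0 hn hen hK hm.
have [L Lu [L1 L2]] := near_auerbach (first_momentD bar) (first_momentZ bar)
  (fun u => @first_moment_gt0 R n mu bar u lc.2).
pose r : R := K%:R * (6 * n%:R).
have r0 : 0 <= r by rewrite !mulr_ge0.
have m0 : 0 < m%:R :> R by rewrite ltr0n ltnW.
pose net := {ffun 'I_n -> 'I_(2 * m).+1}.
pose v (f : net) : V := net_point R f *m L.
pose eta := r / m%:R.
have nR : 0 < n%:R :> R by rewrite ltr0n.
have eta0 : 0 < eta by rewrite divr_gt0// /r !mulr_gt0// ltr0n.
have tailr := l1norm_tail lc bar Lu L1 n0 K0; rewrite -/r in tailr.
have cphi := @continuous_l1norm R n L.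
have mT : measurable ([set x | r <= l1norm L x] : set (borelRn R n)).
  exact: (measurable_superlevel r (continuous_measurable_rV cphi)).
have mF : measurable ([set x | l1norm L x <= r] : set (borelRn R n)).
  by apply: compact_measurable_rV; exact: compact_l1norm.
have /choice[q Hq] : forall f : net, exists q, wide R f ->
    [/\ 32^-1 <= q, (eps%:E <= mu [set x | (q <= dot (v f) x)%R])%E &
    (mu [set x | (q + eta <= dot (v f) x)%R] <= eps%:E)%E].
  move=> f; have [/existsP[j fj]|nf] := boolP (wide R f); last by exists 0.
  have lo := halfspace_lower lc bar Lu L1 L2 n0 (net_point_le1 R m1 f) fj hn.
  have hen' : (eps%:E <= ((96 * n%:R ^+ 2)^-1)%:E)%E by rewrite lee_fin.
  have q0 : 0 < 32^-1 :> R by rewrite invr_gt0.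
  have [q ?] := quantile bar e0 eta0 q0 (le_trans hen' lo).
  by exists q.
pose H f := [set x | q f <= dot (v f) x].
(* Non-wide grid points get the trivial sets [setT] and [set0], so that unions and sums may run over
   the whole grid. *)
pose B (f : net) : set V := if wide R f then H f `&` [set x | l1norm L x <= r] else setT.
pose D (f : net) : set V := if wide R f then [set x | q f + eta <= dot (v f) x] else set0.
pose G := ~` ([set x | r <= l1norm L x] `|` \big[setU/set0]_(f <- index_enum net) D f).
have mB f : measurable (B f : set (borelRn R n)).
  by rewrite /B; case: ifP => // _; apply: measurableI => //; exact: measurable_halfspace.
have mD f : measurable (D f : set (borelRn R n)).
  by rewrite /D; case: ifP => // _; exact: measurable_halfspace.
have mDD : measurable (\big[setU/set0]_(f <- index_enum net) D f : set (borelRn R n)).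
  exact: bigsetU_measurable.
have mGc := measurableU _ _ mT mDD.
have mG : measurable (G : set (borelRn R n)) by exact: measurableC.
have netM : #|net|%:R = M by rewrite card_ffun !card_ord.
have muG : 1 - (2 ^+ K)^-1 - M * eps <= fine (mu G).
  rewrite -lee_fin fineK ?fin_num_measure// probability_setC//.
  rewrite -addrA -opprD EFinB leeB// EFinD.
  apply: le_trans (measureU2 _ _ _) _ => //.
  apply: leeD => //; apply: le_trans (measure_bigsetU_le _ _ _) _ => //.
  apply: le_trans (lee_sum _ (_ : forall f, xpredT f -> (_ <= eps%:E)%E)) _.
    move=> f _; rewrite /D; case: ifPn => [/Hq[]//|_].
    by rewrite measure0 lee_fin ltW.
  by rewrite sumEFin sumr_const -mulr_natl netM.
(* Cutting the halfspace by the [l1norm] ball costs at most [2 ^ (- K) <= eps / 2]. *)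
have muB f : eps / 2 <= fine (mu (B f)).
  rewrite -lee_fin fineK ?fin_num_measure// /B; case: ifPn => [wf|_]; last first.
    rewrite [leRHS](_ : _ = 1%E); last exact: probability_setT.
    rewrite lee_fin; apply: (@le_trans _ _ eps); first by lra.
    apply: le_trans hen _; rewrite invf_le1 ?mulr_gt0 ?exprn_gt0//.
    have : 1 <= n%:R :> R by rewrite ler1n.
    by nra.
  have [_ h _] := Hq f wf.
  have mH : measurable (H f : set (borelRn R n)) by exact: measurable_halfspace.
  have : (eps%:E <= mu (H f `&` [set x | (l1norm L x <= r)%R]) + mu [set x | (r <= l1norm L x)%R])%E.
    apply: le_trans h _; apply: le_trans (measureU2 _ _ _) => //; last exact: measurableI.
    apply: le_measure; rewrite ?inE//.
      by apply: measurableU => //; exact: measurableI.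
    by move=> x Hx; have [xr|rx] := leP (l1norm L x) r; [left|right; exact: ltW].
  have t2 : (mu [set x | (r <= l1norm L x)%R] <= (eps / 2)%:E)%E.
    by apply: le_trans tailr _; rewrite lee_fin.
  move=> /le_trans/(_ (leeD2l _ t2)).
  by rewrite -leeBlDr// -EFinB; apply: le_trans; rewrite lee_fin; lra.
have c01 : 0 <= fine (mu G) <= 1.
  rewrite fine_ge0//= -lee_fin fineK ?fin_num_measure//; exact: probability_le1.
apply: (@le_trans _ _ (fine (mu G) - \sum_(f in [set: net]%SET) (1 - fine (mu (B f))) ^+ N)%:E).
  rewrite lee_fin lerB//.
  apply: le_trans (ler_sum _ (_ : forall f, f \in [set: net]%SET -> _ <= (1 - eps / 2) ^+ N)) _.
    move=> f _; apply: lerXn2r.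
    - rewrite nnegrE subr_ge0 -lee_fin fineK ?fin_num_measure//; exact: probability_le1.
    - rewrite nnegrE subr_ge0; apply: le_trans (muB f) _.
      rewrite -lee_fin fineK ?fin_num_measure//; exact: probability_le1.
    - by rewrite lerB.
  by rewrite sumr_const cardsT -[leLHS]mulr_natl netM.
(* On the event that all [B f] are hit, the dilated hull contains [G], so its measure is at least
   the constant [mu G]; off this event 0 is enough. *)
have hit_le := @iter_int_hits R n mu net B (fine (mu G)) N [set: net]%SET mB c01.
apply: (le_trans hit_le); rewrite /expected_cover.
apply: le_iter_int => s; first by rewrite lee_fin; case: ifP => //; case/andP: c01.
have cK : compact (scale_set (1 + delta) (hull s)).
  apply: continuous_compact; last exact: hull_compact.
  by apply: continuous_subspaceT; exact: scaler_continuous.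
case: ifPn => [hs|_]; last exact: measure_ge0.
rewrite fineK ?fin_num_measure//; apply: le_measure; rewrite ?inE//.
  exact: compact_measurable_rV.
move=> x Gx.
have [xr xD] : l1norm L x < r /\ forall f, ~ D f x.
  split; first by rewrite ltNge; apply/negP => h; apply: Gx; left.
  move=> f Dx; apply: Gx; right; rewrite -bigcup_seq; exists f => //=.
  by rewrite mem_index_enum.
apply: (@net_cover R n m m1 L Lu n0 delta r eta 32^-1 q) => //.
- by move=> f /Hq[].
(* Since [delta < 1], the left side is [(3 + delta) eta <= 4 eta <= delta / 32]. *)
- rewrite /eta -/r in hm *; move: (r / m%:R) hm eta0 => w; nra.
- move=> f wf; move/forall_inP: hs => /(_ f); rewrite inE => /(_ isT)/hasP[z zs].
  by rewrite inE /B wf => -[hz1 hz2]; exists z.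
- by move=> f wf; rewrite ltNge; apply/negP => h; apply: (xD f); rewrite /D wf.
- exact: ltW.
Qed.

End expected_cover_lower.

(** * Numerical choice of the parameters *)

Lemma pow7_le_exp2 (n : nat) : (64 <= n)%N -> (2 * n ^ 7 <= 2 ^ n)%N.
Proof.
(* With [j = n / 16] rounded down, [n <= 2 ^ (4 + j)], so the left side is at most [2 ^ (29 + 7 j)];
   and [29 + 7 j <= 16 j] once [j >= 4]. *)
move=> n64; pose j := (n %/ 16)%N.
have j4 : (4 <= j)%N by rewrite (@leq_divRL 4 n 16).
have jn : (j * 16 <= n)%N by exact: leq_divM.
have nj : (n <= 2 ^ (4 + j))%N.
  apply: leq_trans (ltnW (ltn_ceil n (isT : (0 < 16)%N))) _.
  by rewrite expnD mulnC leq_mul2l/=; exact: ltn_expl.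
apply: (@leq_trans (2 * 2 ^ ((4 + j) * 7))).
  by rewrite leq_mul2l/= expnM leq_exp2r.
by rewrite -expnS leq_exp2l//; lia.
Qed.

Section numerics.
Variable R : realType.

(** Induction from [(1 - p) (1 + (N + 1) p) <= 1 + N p]. The resulting decay [1 / (1 + N p)]
    suffices, because [N] will far exceed [1 / p]. *)
Lemma one_sub_expr_le (p : R) (N : nat) : 0 < p <= 1 ->
  (1 - p) ^+ N * (1 + N%:R * p) <= 1.
Proof.
move=> /andP[p0 p1]; elim: N => [|N IH]; first by rewrite expr0 mul0r addr0 mulr1.
apply: le_trans IH; rewrite exprS -mulrA mulrCA ler_wpM2l//.
  by rewrite exprn_ge0// subr_ge0.
rewrite -natr1; have N0 : 0 <= N%:R :> R by [].
by nra.
Qed.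

(** As [1 / delta >= 1] and [ln (2 / delta) >= ln 2], the constant [14 / ln 2] makes the exponent at
    least [14 n ln n]. *)
Lemma threshold_ge (n : nat) (delta : R) : (0 < n)%N -> 0 < delta < 1 ->
  (n ^ (14 * n))%N%:R <= threshold n (14 / ln 2) delta.
Proof.
move=> n0 /andP[d0 d1]; rewrite /threshold.
have nR : 0 < n%:R :> R by rewrite ltr0n.
have l2 : 0 < ln 2 :> R by rewrite ln_gt0// ltr1n.
rewrite natrX -[X in X ^+ _](lnK nR) -expRM_natl ler_expR.
have lnn : 0 <= ln n%:R :> R by rewrite ln_ge0// ler1n.
rewrite natrM ler_wpM2r// ler_wpM2r//.
have h1 : 1 <= delta^-1 by rewrite invf_ge1// ltW.
have h2 : ln 2 <= ln (2 / delta) by rewrite ler_ln ?posrE ?divr_gt0// ler_peMr.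
apply: (@le_trans _ _ (14 / ln 2 * ln 2)); first by rewrite divfK// gt_eqF.
apply: ler_pM => //; first by rewrite divr_ge0// ltW.
- exact: ltW.
- by rewrite ler_peMr// divr_ge0// ltW.
Qed.

(** With [eps = n ^ (- 7 n)], [m = n ^ 5] and [K = n ^ 2], the three losses are at most [1 / n],
    [1 / n] and [2 / n]. *)
Lemma expected_cover_large (n : nat) (mu : probability (borelRn R n) R)
    (delta : R) (N : nat) :
  log_concave mu -> barycenter0 mu -> 0 < delta < 1 ->
  (768 <= n)%N -> delta^-1 <= n%:R ->
  threshold n (14 / ln 2) delta <= N%:R ->
  ((1 - 4 / n%:R)%:E <= expected_cover mu delta N)%E.
Proof.
move=> lc bar d01 n768 dn thr; have /andP[d0 d1] := d01.
have n0 : (0 < n)%N by exact: leq_trans n768.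
have nR : 0 < n%:R :> R by rewrite ltr0n.
have n768R : 768 <= n%:R :> R by rewrite ler_nat.
have p7 : (2 * n ^ 7 <= 2 ^ n)%N by apply: pow7_le_exp2; exact: leq_trans n768.
pose eps : R := ((n ^ (7 * n))%N%:R)^-1.
pose m := (n ^ 5)%N; pose K := (n ^ 2)%N.
have pos k : (0 < n ^ k)%N by rewrite expn_gt0 n0.
have posR k : 0 < (n ^ k)%N%:R :> R by rewrite ltr0n.
have eps0 : 0 < eps by rewrite invr_gt0.
have h3n : (192 * (n * (n + 2)) <= n ^ 3)%N.
  have : (n + 2 <= 2 * n)%N by rewrite mul2n -addnn leq_add2l; exact: leq_trans n768.
  move=> h; rewrite (@leq_trans (192 * (n * (2 * n))))%N//.
    by rewrite !leq_mul2l h !orbT.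
  rewrite (_ : 192 * (n * (2 * n)) = n * n * 384)%N; last by ring.
  by rewrite (expnSr n 2) leq_mul// ?(leq_trans _ n768)// expnS expn1.
have hn : 6 * n%:R * (n%:R + 2) / 2 ^+ n <= 32^-1 :> R.
  rewrite ler_pdivrMr ?exprn_gt0// ler_pdivlMl//.
  have : (192 * (n * (n + 2)))%N%:R <= (2 ^ n)%N%:R :> R.
    rewrite ler_nat; apply: leq_trans h3n _; apply: leq_trans p7.
    by rewrite (leq_trans (leq_pexp2l n0 (isT : (3 <= 7)%N)))// leq_pmull.
  by rewrite natrX !natrM natrD; apply: le_trans; rewrite le_eqVlt; apply/orP; left; apply/eqP; ring.
have hen : eps <= (96 * n%:R ^+ 2)^-1.
  rewrite lef_pV2 ?posrE ?mulr_gt0 ?exprn_gt0//.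
  rewrite -natrX -natrM ler_nat; apply: (@leq_trans (n ^ 3)).
    by rewrite (expnSr n 2) mulnC leq_mul2l (leq_trans _ n768) ?orbT.
  by apply: leq_pexp2l => //; rewrite (@leq_trans 7)// leq_pmulr.
(* Here [2 ^ (n ^ 2) = (2 ^ n) ^ n >= (2 n ^ 7) ^ n >= 2 n ^ (7 n)]. *)
have hK : (2 ^+ K)^-1 <= eps / 2.
  rewrite /eps -invfM lef_pV2 ?posrE ?mulr_gt0 ?exprn_gt0//.
  rewrite -natrX -natrM ler_nat /K.
  apply: (@leq_trans ((2 * n ^ 7) ^ n)).
    rewrite expnMn -expnM mulnC leq_mul2r; apply/orP; right.
    by rewrite -{1}(expn1 2) leq_pexp2l.
  by rewrite (_ : n ^ 2 = n * n)%N ?expnM ?leq_exp2r// expnS expn1.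
(* This step needs [n >= 768 = 24 * 32]: with [delta n >= 1] it gives [delta n ^ 2 >= 768]. *)
have hm : 4 * (K%:R * (6 * n%:R) / m%:R) <= delta / 32.
  have -> : 4 * (K%:R * (6 * n%:R) / m%:R) = 24 / n%:R ^+ 2 :> R.
    by rewrite /K /m !natrX; field; rewrite gt_eqF.
  have dn' : 1 <= delta * n%:R by rewrite mulrC -ler_pdivrMr// mul1r.
  rewrite ler_pdivrMr ?exprn_gt0//.
  by nra.
have m1 : (1 < m)%N.
  by rewrite /m (@leq_trans n)// ?(leq_trans _ n768)// -{1}(expn1 n) leq_pexp2l.
have K0 : (0 < K)%N by exact: pos.
have main := @expected_cover_ge R n mu lc bar m K N delta eps n0 m1 K0 d01 eps0 hn hen hK hm.
apply: le_trans main.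
set M := (_ ^ _)%N%:R : R.
(* The grid has [2 n ^ 5 + 1 <= 3 n ^ 5 <= n ^ 6] values per coordinate. *)
have MM : M <= (n ^ (6 * n))%N%:R.
  rewrite ler_nat expnM leq_exp2r//.
  rewrite -addn1; apply: (@leq_trans (n ^ 5 * 3)).
    by rewrite /m -[3%N]/(2 + 1)%N mulnDr muln1 mulnC leq_add2l.
  by rewrite (expnSr n 5) leq_mul2l (leq_trans _ n768) ?orbT.
have epsE : eps = ((n ^ (6 * n))%N%:R)^-1 * ((n ^ n)%N%:R)^-1.
  by rewrite /eps -invfM -natrM -expnD -mulSnr.
have nn : ((n ^ n)%N%:R)^-1 <= n%:R^-1 :> R.
  by rewrite lef_pV2 ?posrE// ler_nat -{1}(expn1 n) leq_pexp2l.
have M0 : 0 <= M by [].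
have Meps : M * eps <= n%:R^-1.
  apply: le_trans nn; rewrite epsE mulrA -[leRHS]mul1r ler_wpM2r ?invr_ge0//.
  by rewrite ler_pdivrMr// mul1r.
have eps1 : eps <= n%:R^-1.
  by rewrite lef_pV2 ?posrE// ler_nat -{1}(expn1 n) leq_pexp2l// muln_gt0.
have n1 : n%:R^-1 <= 1 :> R by rewrite invf_le1// ler1n.
have Keps : (2 ^+ K)^-1 <= n%:R^-1 :> R by lra.
have NN : (n ^ (14 * n))%N%:R <= N%:R :> R.
  exact: le_trans (threshold_ge n0 d01) thr.
have Neps : (n ^ (7 * n))%N%:R / 2 <= N%:R * (eps / 2) :> R.
  rewrite mulrA ler_pM2r ?invr_gt0// /eps ler_pdivlMr// -natrM -expnD -mulnDl.
  exact: NN.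
(* Since [N eps / 2 >= n ^ (7 n) / 2], the power is at most [2 eps], and [M eps <= 1 / n]. *)
have last : M * (1 - eps / 2) ^+ N <= 2 / n%:R.
  have e01 : 0 < eps / 2 <= 1 by apply/andP; split; lra.
  have := one_sub_expr_le N e01; set w := (1 - eps / 2) ^+ N => hw.
  have w0 : 0 <= w by rewrite exprn_ge0//; lra.
  have : w <= 2 * eps.
    have P7 : 0 < (n ^ (7 * n))%N%:R :> R by [].
    have : w * ((n ^ (7 * n))%N%:R / 2) <= 1.
      by apply: le_trans hw; rewrite ler_wpM2l// (le_trans Neps)// lerDr.
    by rewrite -ler_pdivlMr ?divr_gt0// mul1r invf_div.
  move=> /(ler_wpM2l M0)/le_trans; apply.
  by rewrite mulrCA ler_pM2l.
have arith (a b c d : R) : a <= d -> b <= d -> c <= 2 * d -> 1 - 4 * d <= 1 - a - b - c.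
  by clear; lra.
by rewrite lee_fin; exact: arith.
Qed.

End numerics.

(** * Upper bound by 1 and passage to the limit *)

Lemma iter_int_le1 (R : realType) (n : nat) (mu : probability (borelRn R n) R)
    (N : nat) (F : seq 'rV[R]_n -> \bar R) :
  (forall s, 0 <= F s <= 1)%E -> (iter_int mu N F <= 1)%E.
Proof.
move=> F01; rewrite -[leRHS](iter_int_cst mu N 1).
by apply: le_iter_int => s; case/andP: (F01 s).
Qed.

Lemma inf_over_mu_le1 (R : realType) (n : nat) (C delta : R) :
  (inf_over_mu n C delta <= 1)%E.
Proof.
have [mu mu_ok] := @exists_log_concave_barycenter0 R n.
apply: (@le_trans _ _ (inf_over_N mu C delta)); first by apply: ereal_inf_lbound; exists mu.
(* A sample size beyond the threshold, so that the inner infimum runs over a nonempty set. *)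
pose N := (Num.truncn (threshold n C delta)).+1.
apply: (@le_trans _ _ (expected_cover mu delta N)).
  by apply: ereal_inf_lbound; exists N => //=; rewrite ltW// truncnS_gt.
apply: iter_int_le1 => s; rewrite measure_ge0/=; apply: probability_le1.
apply: compact_measurable_rV; apply: continuous_compact; last exact: hull_compact.
by apply: continuous_subspaceT; exact: scaler_continuous.
Qed.

Theorem theorem1p6 (R : realType) :
  exists C : R, 0 < C /\
    forall delta : R, 0 < delta < 1 ->
      (fun n : nat => inf_over_mu n C delta) @ \oo --> (1%:E : \bar R).
Proof.
exists (14 / ln 2); split; first by rewrite divr_gt0// ln_gt0// ltr1n.
move=> delta d01.
(* [harmonic n] is [1 / (n + 1)], and [4 / n <= 8 / (n + 1)] for [n >= 1]; the shift explains the
   8. *)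
apply: (@squeeze_cvge _ _ _ _ (fun n => (1 - 8 * harmonic n)%:E) _ (fun=> 1%E)).
- near=> n; rewrite inf_over_mu_le1 andbT.
  have n768 : (768 <= n)%N by near: n; exact: nbhs_infty_ge.
  have dn : delta^-1 <= n%:R by near: n; exact: nbhs_infty_ger.
  apply/ereal_infP => _ [mu [lc bar] <-]; apply/ereal_infP => _ [N /= thr <-].
  apply: le_trans (expected_cover_large lc bar d01 n768 dn thr).
  have n0 : 0 < n%:R :> R by rewrite ltr0n (leq_trans _ n768).
  have n1 : 1 <= n%:R :> R by rewrite ler1n (leq_trans _ n768).
  rewrite lee_fin lerD2l lerN2 /harmonic ler_pdivrMr// mulrAC ler_pdivlMr//.
  by rewrite -natr1; lra.
- apply: cvg_EFin; first by near=> n.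
  rewrite -[X in _ --> X]subr0 -[X in _ - X](mulr0 8).
  apply: cvgB; first exact: cvg_cst.
  by apply: cvgM; [exact: cvg_cst|exact: cvg_harmonic].
- exact: cvg_cst.
Unshelve. all: by end_near.
Qed.
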